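(* Let $D\subset\mathbb{R}^2$ be a connected and simply connected domain with non-empty interior, bounded by a smooth closed curve $\gamma$. Let $H$ be a smooth real-valued function defined on a neighborhood of $D$ which is constant on $\gamma$. Assume that the system $$H_{xx}(x,y)=H_{yy}(x,y),\qquad H_{xy}(x,y)=0$$ has only isolated solutions in $D$, none of which lie on $\gamma$. Let $\gamma(t)$ be an arc length parametrization of $\gamma$, oriented as the boundary of $D$, let $k(t)$ be its curvature and $n(t)$ the inward unit normal, and write $H(t,s):=H(\gamma(t)+s\,n(t))$ for $|s|$ small. Suppose that one of the following holds: (i) $H_{ss}(t,0)+k(t)H_s(t,0)\neq 0$ for all $t$; (ii) the normal derivative of $H$ vanishes identically along $\gamma$. Then the system above has two solutions in the interior of $D$, counted with multiplicities.
   Context: The solutions of the system are exactly the zeros of the vector field $V=(H_{yy}-H_{xx})\,\partial_x-2H_{xy}\,\partial_y$ (they are the conformal points of the Hamiltonian vector field $H_y\partial_x-H_x\partial_y$, i.e. points where the Hessian of $H$ is a scalar matrix). ''Counted with multiplicities'' means that the multiplicity of a solution is the index of the corresponding isolated zero of $V$; the claim is that the sum of these indices over the interior of $D$ equals $2$. *)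

(* Defs.v *)
From HB Require Import structures.
From mathcomp Require Import all_boot all_order all_algebra.
From mathcomp Require Import all_classical all_reals all_analysis.
Set Implicit Arguments. Unset Strict Implicit. Unset Printing Implicit Defensive.
Import Order.TTheory GRing.Theory Num.Theory.
Import numFieldNormedType.Exports.
Local Open Scope classical_set_scope.
Local Open Scope ring_scope.

Section Defs.
Variable R : realType.
Implicit Types (f : R * R -> R) (p : R * R).

Definition dx f : R * R -> R := fun p => derive1 (fun u => f (u, p.2)) p.1.
Definition dy f : R * R -> R := fun p => derive1 (fun v => f (p.1, v)) p.2.

Definition iter_partial (w : seq bool) f : R * R -> R :=
  foldr (fun b g => if b then dx g else dy g) f w.

Definition smooth_on (U : set (R * R)) f : Prop :=
  forall w : seq bool, forall p, U p ->
    [/\ derivable (fun u => iter_partial w f (u, p.2)) p.1 1,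
        derivable (fun v => iter_partial w f (p.1, v)) p.2 1
      & {for p, continuous (iter_partial w f)}].

Definition smooth1 (g : R -> R) : Prop :=
  forall (n : nat) (t : R), derivable (derive1n n g) t 1.

Definition Hxx f := dx (dx f).
Definition Hyy f := dy (dy f).
Definition Hxy f := dy (dx f).

Definition conformal_pt f p : Prop := Hxx f p = Hyy f p /\ Hxy f p = 0.

Definition Vfield f p : R * R := (Hyy f p - Hxx f p, - (2 * Hxy f p)).

(* index of an isolated zero p of a planar vector field V: for all small
   radii rho, V does not vanish on the circle of radius rho around p, and
   the angle of V along the positively oriented circle has a continuous
   lift whose total increase is 2 pi n *)
Definition has_index (V : R * R -> R * R) p (n : int) : Prop :=
  exists r : R, 0 < r /\
  forall rho : R, 0 < rho < r ->
    let c := fun t : R => V (p.1 + rho * cos (2 * pi * t),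
                             p.2 + rho * sin (2 * pi * t)) in
    (forall t : R, 0 <= t <= 1 -> c t != (0, 0)) /\
    exists theta : R -> R, continuous theta /\
      (forall t : R, 0 <= t <= 1 ->
         c t = (Num.sqrt ((c t).1 ^+ 2 + (c t).2 ^+ 2) * cos (theta t),
                Num.sqrt ((c t).1 ^+ 2 + (c t).2 ^+ 2) * sin (theta t))) /\
      theta 1 - theta 0 = 2 * pi * n%:~R.

End Defs.

(* Main.v *)
(* In complex notation [V = - 4 d^2 H / d zbar^2], so that along the boundary [V]
   is the square of the unit tangent times a function whose real part is
   [H_ss + k H_s]. This number is nonzero, also when the normal derivative
   vanishes identically, and hence [V] turns twice as often as the tangent, that
   is, twice (Hopf's Umlaufsatz). On the other hand the turning of [V] along the
   boundary is the sum of its indices inside: away from the zeros of [V] the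
   turning of [V] along a loop is a fixed linear combination of the winding
   numbers of the loop around finitely many points, and the boundary curve winds
   once around the points inside and not around those outside. *)

Require Import Defs.
From HB Require Import structures.
From mathcomp Require Import all_boot all_order all_algebra.
From mathcomp Require Import all_classical all_reals all_analysis.
From mathcomp Require Import ring lra zify.
Import Order.TTheory GRing.Theory Num.Theory.
Import numFieldNormedType.Exports.
Local Open Scope classical_set_scope.
Local Open Scope ring_scope.

Set Implicit Arguments.
Unset Strict Implicit.

(** * Arguments and angles in the plane *)

Section Plane.
Variable R : realType.
Implicit Types (u v w : R * R) (a b : R).

(** The domain is known only through its interior and its boundary, so neither a triangulation of it
    nor a homotopy from the boundary curve to small circles is at hand. Two devices take their
    place. For the turning of [V], a square grid covering the region carries the angles between the
    values of [V] at neighbouring vertices as a discrete one-form; it fails to be closed only in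
    squares away from the region, and there the angle forms of the centres of the squares compensate
    for it, whatever the shape of the region. For the boundary curve, each point off it is joined,
    without meeting the curve, to a point just above or just below the lowest point of the curve;
    both the side of the curve and the winding number are constant along the way and can be read off
    at the end. The Umlaufsatz follows from these winding numbers, by comparing the curve with its
    copy pushed inwards. Lifts are built as sums of principal angles between consecutive vectors at
    less than a right angle, a range in which such angles add up without an ambiguity of 2 pi. *)

Definition cmod u : R := Num.sqrt (u.1 ^+ 2 + u.2 ^+ 2).
Definition cmul u v : R * R := (u.1 * v.1 - u.2 * v.2, u.1 * v.2 + u.2 * v.1).
Definition dot u v : R := u.1 * v.1 + u.2 * v.2.
Definition crs u v : R := u.1 * v.2 - u.2 * v.1.
(* Half-angle formula for the principal argument. On the closed negative real
   axis the denominator vanishes and [carg] takes the junk value [0]. *)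
Definition carg u : R := 2 * atan (u.2 / (cmod u + u.1)).
(** The pair is the complex number conj(u) v, so this is the oriented angle from [u] to [v], up to
    the junk value of [carg]. *)
Definition ang u v : R := carg (dot u v, crs u v).
Definition polar u a : Prop := u = (cmod u * cos a, cmod u * sin a).

Lemma cmod_ge0 u : 0 <= cmod u.
Proof. exact: sqrtr_ge0. Qed.

Lemma cmod_sqr u : cmod u ^+ 2 = u.1 ^+ 2 + u.2 ^+ 2.
Proof. by rewrite sqr_sqrtr// addr_ge0// sqr_ge0. Qed.

Lemma pair_eq0 u : (u == 0) = (u.1 == 0) && (u.2 == 0).
Proof. by case: u. Qed.

Lemma cmod_gt0 u : (0 < cmod u) = (u != 0).
Proof.
rewrite sqrtr_gt0 lt_neqAle addr_ge0 ?sqr_ge0// andbT eq_sym.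
by rewrite paddr_eq0 ?sqr_ge0// !sqrf_eq0 -pair_eq0.
Qed.

Lemma cmod_mul u v : cmod (cmul u v) = cmod u * cmod v.
Proof.
rewrite /cmod -sqrtrM ?addr_ge0 ?sqr_ge0//; congr Num.sqrt.
by rewrite /cmul /=; ring.
Qed.

Lemma cmul_neq0 u v : u != 0 -> v != 0 -> cmul u v != 0.
Proof. by rewrite -!cmod_gt0 cmod_mul => *; exact: mulr_gt0. Qed.

Lemma cmodN u : cmod (- u) = cmod u.
Proof. by rewrite /cmod /= !sqrrN. Qed.

Lemma cmod_ge u : u.1 <= cmod u /\ - cmod u <= u.1.
Proof. by have := cmod_sqr u; have := cmod_ge0 u; split; nra. Qed.

(** The sum is the denominator in [carg]; its positivity expresses, from here on, membership in the
    plane cut along the closed negative real axis. *)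
Lemma cmod_slit u : (0 < cmod u + u.1) = (u.2 != 0) || (0 < u.1).
Proof.
have h := cmod_sqr u; have h0 := cmod_ge0 u.
have [u2|u2] := eqVneq u.2 0 => /=; last first.
  have : 0 < u.2 ^+ 2 by rewrite exprn_even_gt0.
  nra.
apply/idP/idP => [|u1]; last by rewrite ltr_wpDl.
by rewrite !ltNge; apply: contra => u1; rewrite u2 in h; nra.
Qed.

(** With x the tangent of the half angle, 1 + x^2 = 2|u| / (|u| + u.1). So the squared cosine of the
    half angle is (|u| + u.1) / (2|u|), and the double-angle formulas return [u]. *)
Lemma polar_carg u : 0 < cmod u + u.1 -> polar u (carg u).
Proof.
move=> s0; have h := cmod_sqr u; have h0 := cmod_ge0 u.
have N0 : 0 < cmod u by have [] := cmod_ge u; lra.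
set x := u.2 / (cmod u + u.1).
have c0 : 0 < cos (atan x) by rewrite cos_gt0_pihalf// atan_gtNpi2 atan_ltpi2.
have ex : sin (atan x) = x * cos (atan x).
  have := atanK x; rewrite /tan => {2}<-; rewrite mulfVK//; exact: lt0r_neq0.
have c2 : cos (atan x) ^+ 2 * (1 + x ^+ 2) = 1.
  by rewrite -[RHS](cos2Dsin2 (atan x)) ex; ring.
have x2 : 1 + x ^+ 2 = 2 * cmod u / (cmod u + u.1).
  rewrite /x; apply: (mulIf (lt0r_neq0 s0)); rewrite mulfVK ?lt0r_neq0//.
  apply: (mulIf (lt0r_neq0 s0)).
  rewrite -!mulrA mulrDl mul1r -expr2 -exprMn mulfVK ?lt0r_neq0//.
  by have e : u.2 ^+ 2 = cmod u ^+ 2 - u.1 ^+ 2 by [rewrite h; ring]; rewrite e; ring.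
have c2' : 2 * cmod u * cos (atan x) ^+ 2 = cmod u + u.1.
  have : cos (atan x) ^+ 2 * (2 * cmod u / (cmod u + u.1)) * (cmod u + u.1) = 1 * (cmod u + u.1).
    by rewrite -x2 c2.
  by rewrite mulrA mulfVK ?lt0r_neq0// mul1r => <-; ring.
rewrite /polar /carg -/x (_ : 2 * atan x = atan x + atan x); last by ring.
rewrite cosD sinD ex [LHS]surjective_pairing; congr pair.
  have -> : x * cos (atan x) * (x * cos (atan x)) = 1 - cos (atan x) ^+ 2.
    by rewrite -(cos2Dsin2 (atan x)) ex; ring.
  rewrite (_ : cmod u * _ = 2 * cmod u * cos (atan x) ^+ 2 - cmod u); last by ring.
  by rewrite c2'; ring.
rewrite (_ : cmod u * _ = 2 * cmod u * cos (atan x) ^+ 2 * x); last by ring.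
by rewrite c2' /x mulrCA mulfV ?mulr1// lt0r_neq0.
Qed.

Lemma polar_ex u : exists a, polar u a.
Proof.
have [s|] := ltP 0 (cmod u + u.1); first by exists (carg u); exact: polar_carg.
rewrite leNgt cmod_slit negb_or negbK => /andP[/eqP u2 u1].
exists pi; rewrite /polar cospi sinpi mulr0 mulrN1 [LHS]surjective_pairing u2.
congr pair; have := cmod_sqr u; have := cmod_ge0 u; rewrite u2 -leNgt in u1 *; nra.
Qed.

Lemma polar_mul u v a b : polar u a -> polar v b -> polar (cmul u v) (a + b).
Proof.
rewrite /polar cmod_mul => {1}-> {1}->; rewrite cosD sinD /cmul /=.
by congr pair; ring.
Qed.

Lemma polarN u a : polar u a -> polar (- u) (a + pi).
Proof.
rewrite /polar cmodN cosDpi sinDpi => {1}->.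
by rewrite !mulrN.
Qed.

Lemma polar_period u a (n : int) : polar u a -> polar u (a + 2 * pi * n%:~R).
Proof.
suff [c s] : cos (a + 2 * pi * n%:~R) = cos a /\ sin (a + 2 * pi * n%:~R) = sin a.
  by rewrite /polar c s.
have p k : 2 * pi * (Posz k)%:~R = (pi *+ 2 *+ k) :> R.
  by rewrite -mulrnA pmulrn -(mulr_natl pi) natrM mulrAC.
case: n => k; first by rewrite p (periodicn (@cosD2pi R)) (periodicn (@sinD2pi R)).
rewrite NegzE mulrNz mulrN p; split.
  by rewrite -[in RHS](subrK (pi *+ 2 *+ k.+1) a) (periodicn (@cosD2pi R)).
by rewrite -[in RHS](subrK (pi *+ 2 *+ k.+1) a) (periodicn (@sinD2pi R)).
Qed.

Lemma sincos_eq a b : cos a = cos b -> sin a = sin b ->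
  exists n : int, a - b = 2 * pi * n%:~R.
Proof.
move=> cab sab; have pi0 := pi_gt0 R.
have d1 : cos (a - b) = 1 by rewrite cosB cab sab -!expr2 cos2Dsin2.
pose n := Num.floor ((a - b) / (2 * pi)); exists n.
have p2 : 0 < 2 * pi :> R by lra.
have /andP[n1 n2] := floor_itv ((a - b) / (2 * pi)); rewrite -/n in n1 n2.
move: n1 n2; rewrite ler_pdivlMr// ltr_pdivrMr// intrD => n1 n2.
(* The difference reduced to [0, 2 pi). Injectivity of [cos] on [0, pi] applies to [r] or to
   [2 * pi - r]. *)
set r := a - b - 2 * pi * n%:~R.
have r1 : cos r = 1.
  have := @polar_period (1, 0) (a - b) (- n).
  rewrite /polar /cmod /= expr1n expr0n addr0 sqrtr1 !mul1r mulrNz mulrN -/r d1 => H.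
  have s0 : sin (a - b) = 0.
    have := cos2Dsin2 (a - b); rewrite d1 expr1n => /eqP.
    by rewrite addrC -subr_eq0 addrK sqrf_eq0 => /eqP.
  have : (1, 0) = (cos r, sin r) by apply: H; rewrite s0.
  by case.
suff : r = 0 by rewrite /r; lra.
have [rp|rp] := leP r pi.
  by apply: cos_inj; rewrite ?in_itv /= ?cos0 ?lexx ?pi_ge0 ?rp ?andbT// /r; lra.
have : 2 * pi - r = 0.
  apply: cos_inj; rewrite ?in_itv /= ?lexx ?pi_ge0//; first by rewrite /r in rp *; lra.
  rewrite cos0 cosB (_ : 2 * pi = pi *+ 2); last by rewrite mulr_natl.
  by rewrite cos2pi sin2pi r1; lra.
by rewrite /r; lra.
Qed.

Lemma polar_uniq u a b : u != 0 -> polar u a -> polar u b ->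
  exists n : int, a - b = 2 * pi * n%:~R.
Proof.
rewrite -cmod_gt0 => N0 ua ub.
have [e1 e2] : (cmod u * cos a, cmod u * sin a) = (cmod u * cos b, cmod u * sin b).
  by rewrite -ua -ub.
by apply: sincos_eq; apply: (mulfI (lt0r_neq0 N0)).
Qed.

Lemma carg_bound u : 0 <= u.1 -> `|carg u| <= pi / 2.
Proof.
move=> u1; have N0 := cmod_ge0 u.
suff : `|u.2 / (cmod u + u.1)| <= 1.
  rewrite !ler_norml => /andP[/le_atan + /le_atan]; rewrite atanN atan1 /carg => *; lra.
have [->|s0] := eqVneq (cmod u + u.1) 0; first by rewrite invr0 mulr0 normr0.
have s1 : 0 < cmod u + u.1 by rewrite lt_neqAle eq_sym s0 addr_ge0.
rewrite normrM normfV (gtr0_norm s1) ler_pdivrMr// mul1r ler_norml.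
by have := cmod_sqr u; nra.
Qed.

Lemma carg_bound_pi u : `|carg u| < pi.
Proof.
have := atan_gtNpi2 (u.2 / (cmod u + u.1)).
have := atan_ltpi2 (u.2 / (cmod u + u.1)).
by rewrite /carg ltr_norml => *; lra.
Qed.

(** True on the closed negative real axis as well, where both sides are the junk value 0; this makes
    [ang] antisymmetric without side conditions. *)
Lemma carg_conj a b : carg (a, - b) = - carg (a, b).
Proof. by rewrite /carg /cmod /= sqrrN mulNr atanN mulrN. Qed.

Lemma angC u v : ang v u = - ang u v.
Proof.
rewrite /ang -carg_conj /dot /crs; congr carg; congr pair; ring.
Qed.

Lemma ang_self u : ang u u = 0.
Proof. by have := angC u u; lra. Qed.

(** Multiplying [u] by conj(u) v, which the second hypothesis keeps off the slit, gives |u|^2 v, and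
    the positive factor does not affect the angle. *)
Lemma polar_ang u v a : u != 0 -> (crs u v != 0) || (0 < dot u v) ->
  polar u a -> polar v (a + ang u v).
Proof.
move=> u0 s0 ua; have N0 : 0 < cmod u by rewrite cmod_gt0.
have s : 0 < cmod (dot u v, crs u v) + (dot u v, crs u v).1 by rewrite cmod_slit.
have := polar_mul ua (polar_carg s); rewrite -/(ang u v) /polar cmod_mul.
have -> : cmod (dot u v, crs u v) = cmod u * cmod v.
  rewrite /cmod -sqrtrM ?addr_ge0 ?sqr_ge0//; congr Num.sqrt.
  by rewrite /dot /crs /=; ring.
rewrite /cmul /= => -[e1 e2].
have n2 : cmod u ^+ 2 != 0 by rewrite sqrf_eq0 lt0r_neq0.
rewrite [LHS]surjective_pairing; congr pair; apply: (mulfI n2).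
  transitivity (cmod u * (cmod u * cmod v) * cos (a + ang u v)); last by ring.
  by rewrite -e1 cmod_sqr /dot /crs; ring.
transitivity (cmod u * (cmod u * cmod v) * sin (a + ang u v)); last by ring.
by rewrite -e2 cmod_sqr /dot /crs; ring.
Qed.

Lemma int_pi_eq0 a (n : int) : a = 2 * pi * n%:~R -> `|a| < 2 * pi -> a = 0.
Proof.
have pi0 := pi_gt0 R.
move=> ->; rewrite normrM gtr0_norm ?mulr_gt0// gtr_pMr ?mulr_gt0//.
rewrite -intr_norm (_ : 1 = 1%:~R)// ltr_int.
by case: n => [[|n]|n] //; rewrite mulr0.
Qed.

(* The two sides agree modulo [2 * pi], and the three angles are at most
   [pi / 2] in absolute value, so that they differ by less than [2 * pi]. *)
Lemma ang_cocycle u v w : u != 0 -> v != 0 -> w != 0 ->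
  0 <= dot u v -> 0 <= dot v w -> 0 <= dot u w ->
  ang u v + ang v w = ang u w.
Proof.
move=> u0 v0 w0 uv vw uw.
have slit x y : x != 0 -> y != 0 -> 0 <= dot x y -> (crs x y != 0) || (0 < dot x y).
  rewrite -!cmod_gt0 => x0 y0; rewrite le_eqVlt => /orP[/eqP d0|->]; rewrite ?orbT//.
  apply/orP; left; apply/eqP => c0; have : 0 < cmod x ^+ 2 * cmod y ^+ 2.
    by rewrite mulr_gt0// exprn_gt0.
  rewrite !cmod_sqr; suff -> : (x.1 ^+ 2 + x.2 ^+ 2) * (y.1 ^+ 2 + y.2 ^+ 2) = dot x y ^+ 2 + crs x y ^+ 2.
    by rewrite c0 -d0 expr0n /= addr0 ltxx.
  by rewrite /dot /crs; ring.
have [a ua] := polar_ex u.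
have uv' := polar_ang u0 (slit _ _ u0 v0 uv) ua.
have vw' := polar_ang v0 (slit _ _ v0 w0 vw) uv'.
have uw' := polar_ang u0 (slit _ _ u0 w0 uw) ua.
have [n en] := polar_uniq w0 vw' uw'.
have := @carg_bound (dot u v, crs u v) uv; rewrite -/(ang u v) ler_norml => /andP[? ?].
have := @carg_bound (dot v w, crs v w) vw; rewrite -/(ang v w) ler_norml => /andP[? ?].
have := @carg_bound (dot u w, crs u w) uw; rewrite -/(ang u w) ler_norml => /andP[? ?].
have /(int_pi_eq0 en) : `|a + ang u v + ang v w - (a + ang u w)| < 2 * pi.
  by rewrite ltr_norml; have := pi_gt0 R; lra.
lra.
Qed.

End Plane.

(** * Continuity of the plane operations *)

Section Continuity.
Variables (R : realType) (T : topologicalType).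
Implicit Types (x : T) (f g : T -> R * R).

Lemma cont_pair (f g : T -> R) x : {for x, continuous f} -> {for x, continuous g} ->
  {for x, continuous (fun y => (f y, g y))}.
Proof. by move=> fx gx; exact: (@cvg_pair _ _ _ (nbhs x) (nbhs (f x)) (nbhs (g x))). Qed.

Lemma cont_fst f x : {for x, continuous f} -> {for x, continuous (fun y => (f y).1)}.
Proof. by move=> fx; apply: (cvg_comp _ _ fx); apply: cvg_fst. Qed.

Lemma cont_snd f x : {for x, continuous f} -> {for x, continuous (fun y => (f y).2)}.
Proof. by move=> fx; apply: (cvg_comp _ _ fx); apply: cvg_snd. Qed.

Lemma cont_dot f g x : {for x, continuous f} -> {for x, continuous g} ->
  {for x, continuous (fun y => dot (f y) (g y))}.
Proof.
by move=> fx gx; apply: cvgD; apply: cvgM;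
  [exact: cont_fst|exact: cont_fst|exact: cont_snd|exact: cont_snd].
Qed.

Lemma cont_crs f g x : {for x, continuous f} -> {for x, continuous g} ->
  {for x, continuous (fun y => crs (f y) (g y))}.
Proof.
by move=> fx gx; apply: cvgB; apply: cvgM;
  [exact: cont_fst|exact: cont_snd|exact: cont_snd|exact: cont_fst].
Qed.

Lemma cont_cmul f g x : {for x, continuous f} -> {for x, continuous g} ->
  {for x, continuous (fun y => cmul (f y) (g y))}.
Proof.
move=> fx gx; apply: cont_pair; [apply: cvgB|apply: cvgD]; apply: cvgM;
  by [exact: cont_fst|exact: cont_snd].
Qed.

Lemma cont_carg f x : {for x, continuous f} -> 0 < cmod (f x) + (f x).1 ->
  {for x, continuous (fun y => carg (f y))}.
Proof.
move=> fx s; have f1 := cont_fst fx; have f2 := cont_snd fx.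
apply: cvgMr; apply: continuous_comp; last exact: continuous_atan.
apply: cvgM => //; apply: cvgV; first exact: lt0r_neq0.
apply: cvgD => //.
apply: (@continuous_comp _ _ _ (fun y => (f y).1 ^+ 2 + (f y).2 ^+ 2) Num.sqrt).
  by apply: cvgD; apply: cvgM.
exact: sqrt_continuous.
Qed.

Lemma cont_ang f g x : {for x, continuous f} -> {for x, continuous g} ->
  0 < dot (f x) (g x) -> {for x, continuous (fun y => ang (f y) (g y))}.
Proof.
move=> fx gx d; apply: cont_carg; last by rewrite cmod_slit d orbT.
by apply: cont_pair; [exact: cont_dot|exact: cont_crs].
Qed.

End Continuity.

(** * Uniform bounds from compactness *)

Section Uniform.
Variable R : realType.

Lemma dot_gt0 (u : R * R) : (0 < dot u u) = (u != 0).
Proof. by rewrite -cmod_gt0 /cmod sqrtr_gt0 /dot -!expr2. Qed.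

(** A Lebesgue number argument, from the near-covering form of compactness with [e] tending to 0
    from the right. *)
Lemma compact_right (T : normedModType R) (K : set T) (P : R -> T -> Prop) :
  compact K -> (forall x, K x -> exists2 r : R, 0 < r &
     forall y e, `|x - y| < r -> 0 < e < r -> P e y) ->
  exists2 e : R, 0 < e & forall y, K y -> P e y.
Proof.
move=> /compact_near_coveringP cK KP.
have : \forall e \near 0^'+, K `<=` P e.
  apply: cK => x /KP[r r0 rP].
  exists (ball x r, [set e | 0 < e < r]) => /=.
    split; first exact: nbhsx_ballx.
    near=> e; apply/andP; split; near: e; [exact: nbhs_right_gt|exact: nbhs_right_lt].
  by move=> [y e] /= [xy er]; apply: rP => //; rewrite -ball_normE in xy.
move=> H; have : \forall e \near 0^'+, 0 < e /\ K `<=` P e.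
  by near=> e; split; near: e => //; exact: nbhs_right_gt.
by move=> /filter_ex[e [e0 eP]]; exists e.
Unshelve. all: by end_near. Qed.

(** The points [a] and [b] range over a neighbourhood of [K], not only over [K], because grid
    vertices near [K] may lie outside it. *)
Lemma unif_dot (T : normedModType R) (K : set T) (g : T -> R * R) :
  compact K -> (forall x, K x -> {for x, continuous g}) ->
  (forall x, K x -> g x != 0) ->
  exists2 e : R, 0 < e & forall y, K y -> forall a b,
    `|y - a| < e -> `|y - b| < e -> 0 < dot (g a) (g b).
Proof.
move=> cK gK g0; apply: (compact_right
  (P := fun e y => forall a b, `|y - a| < e -> `|y - b| < e -> 0 < dot (g a) (g b))) => // x Kx.
have d0 : 0 < dot (g x) (g x) by rewrite dot_gt0 g0.
have h : {for (x, x), continuous (fun z : T * T => dot (g z.1) (g z.2))}.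
  apply: cont_dot; apply: continuous_comp => /=; try exact: gK.
    exact: cvg_fst.
  exact: cvg_snd.
have [[A B] [/= /nbhs_ballP[r1 /= r10 A1] /nbhs_ballP[r2 /= r20 B2]] AB] := cvgr_gt _ h _ d0.
exists (Num.min r1 r2 / 2) => [|y e]; first by rewrite divr_gt0// lt_min r10.
set r := Num.min r1 r2 => xy /andP[e0 er] a b ya yb.
apply: (AB (a, b)); split => /=.
  apply: A1; rewrite -ball_normE /ball_ /=.
  rewrite -(subrK y x) -addrA (le_lt_trans (ler_normD _ _))//.
  by have : r <= r1 by [rewrite /r ge_min lexx]; lra.
apply: B2; rewrite -ball_normE /ball_ /=.
rewrite -(subrK y x) -addrA (le_lt_trans (ler_normD _ _))//.
by have : r <= r2 by [rewrite /r ge_min lexx orbT]; lra.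
Qed.

End Uniform.

(** * Continuous lifts and the turning of a loop *)

Section Lift.
Variable R : realType.

Definition unit_itv : set R := [set t | 0 <= t <= 1].

Lemma unit_itvE : unit_itv = [set` `[0, 1]].
Proof. by apply/seteqP; split => t; rewrite /= in_itv. Qed.

Lemma compact_unit : compact unit_itv.
Proof. by rewrite unit_itvE; exact: segment_compact. Qed.

(* The lift adds up the small angles along the ray from [0] to [x]; as the
   subdivision scales with [x], each term is continuous in [x]. *)
Lemma lift_sum (T : normedModType R) (S : set T) (F : T -> R * R) (N : nat) a0 :
  (0 < N)%N -> continuous F -> (forall x, S x -> F x != 0) ->
  (forall x (s : R), S x -> 0 <= s <= 1 -> S (s *: x)) ->
  (forall x k, S x -> (k < N)%N ->
     0 < dot (F ((k%:R / N%:R) *: x)) (F ((k.+1%:R / N%:R) *: x))) ->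
  polar (F 0) a0 ->
  let Th x := a0 + \sum_(k < N) ang (F ((k%:R / N%:R) *: x)) (F ((k.+1%:R / N%:R) *: x)) in
  (forall x, S x -> {for x, continuous Th}) /\ (forall x, S x -> polar (F x) (Th x)).
Proof.
move=> N0 cF F0 star d p0 Th; split=> x Sx.
  apply: cvgD; first exact: cvg_cst.
  apply: cvg_big => [|k _]; first exact: add_continuous.
  apply: cont_ang; last exact: d.
    by apply: continuous_comp; [apply: cvgZr; exact: cvg_id|exact: cF].
  by apply: continuous_comp; [apply: cvgZr; exact: cvg_id|exact: cF].
have N0' : N%:R != 0 :> R by rewrite pnatr_eq0 -lt0n.
suff H n : (n <= N)%N -> polar (F ((n%:R / N%:R) *: x))
    (a0 + \sum_(k < n) ang (F ((k%:R / N%:R) *: x)) (F ((k.+1%:R / N%:R) *: x))).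
  by have := H N (leqnn N); rewrite divff// scale1r.
elim: n => [|n IH] nN; first by rewrite big_ord0 addr0 mul0r scale0r.
rewrite big_ord_recr /= addrA; apply: polar_ang; last exact/IH/ltnW.
  apply: F0; apply: star => //; rewrite divr_ge0//= ler_pdivrMr ?ltr0n//.
  by rewrite mul1r ler_nat ltnW.
by rewrite d ?orbT.
Qed.

Lemma fine_steps (T : normedModType R) (S : set T) (Q : T -> T -> Prop) (e : R) :
  compact S -> 0 < e -> (forall x (s : R), S x -> 0 <= s <= 1 -> S (s *: x)) ->
  (forall y, S y -> forall a, `|y - a| < e -> Q y a) ->
  exists2 N, (0 < N)%N & forall x k, S x -> (k < N)%N ->
    Q ((k%:R / N%:R) *: x) ((k.+1%:R / N%:R) *: x).
Proof.
move=> /compact_bounded[M [_ /(_ (`|M| + 1))]] bS e0 star SQ.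
have {}bS x : S x -> `|x| <= `|M| + 1 by apply: bS; rewrite (le_lt_trans (ler_norm _))// ltrDl.
(* Consecutive points of the ray are |x| / N apart, and |x| <= |M| + 1 < N e. *)
pose N := (Num.truncn ((`|M| + 1) / e)).+1; exists N => // x k Sx kN.
have N0 : 0 < N%:R :> R by rewrite ltr0n.
apply: SQ.
  apply: star => //; rewrite divr_ge0 ?ler0n//= ler_pdivrMr// mul1r ler_nat.
  exact: ltnW.
rewrite -scalerBl normrZ -mulrBl -opprB -natrB// subSnn mulN1r normrN.
rewrite gtr0_norm ?invr_gt0// mulrC ltr_pdivrMr//.
apply: (le_lt_trans (bS _ Sx)); rewrite mulrC -ltr_pdivrMr//.
by rewrite /N truncnS_gt.
Qed.

Lemma lift_ex (T : normedModType R) (S : set T) (F : T -> R * R) :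
  compact S -> S 0 -> continuous F -> (forall x, S x -> F x != 0) ->
  (forall x (s : R), S x -> 0 <= s <= 1 -> S (s *: x)) ->
  exists Th : T -> R, (forall x, S x -> {for x, continuous Th}) /\
    (forall x, S x -> polar (F x) (Th x)).
Proof.
move=> cS S0 cF F0 star.
have [e e0 eP] := unif_dot cS (fun x _ => cF x) F0.
have [N N0 d] := @fine_steps _ S (fun y a => 0 < dot (F y) (F a)) e cS e0 star
  (fun y Sy a ya => eP y Sy y a ltac:(by rewrite subrr normr0) ya).
have [a pa] := polar_ex (F 0).
have [c p] := lift_sum N0 cF F0 star d pa.
by eexists; split; [exact: c|exact: p].
Qed.

Lemma unit_star (x s : R) : unit_itv x -> 0 <= s <= 1 -> unit_itv (s *: x).
Proof.
move=> /andP[x0 x1] /andP[s0 s1]; rewrite /unit_itv /= mulr_ge0//=.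
by rewrite mulr_ile1.
Qed.

Lemma unit0 : unit_itv (0 : R). Proof. by rewrite /unit_itv /= lexx ler01. Qed.
Lemma unit1 : unit_itv (1 : R). Proof. by rewrite /unit_itv /= lexx ler01. Qed.

Definition square : set (R * R) := unit_itv `*` unit_itv.

Lemma compact_square : compact square.
Proof. exact: compact_setX compact_unit compact_unit. Qed.

Lemma square_star (x : R * R) (s : R) : square x -> 0 <= s <= 1 -> square (s *: x).
Proof. by move=> [x1 x2] s01; split; exact: unit_star. Qed.

(** If the end values differed, some 2 pi k + pi between them would be attained, by the intermediate
    value theorem, and this is not a multiple of 2 pi. *)
Lemma int_const (f : R -> R) a b : a <= b ->
  (forall t, a <= t <= b -> {for t, continuous f}) ->
  (forall t, a <= t <= b -> exists n : int, f t = 2 * pi * n%:~R) -> f a = f b.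
Proof.
move=> ab cf fZ; have pi0 := pi_gt0 R.
have wf : {within [set` `[a, b]], continuous f}.
  by apply: continuous_in_subspaceT => t; rewrite inE /= in_itv; exact: cf.
have [n fa] := fZ a ltac:(by rewrite lexx ab).
have [m fb] := fZ b ltac:(by rewrite lexx ab).
have key (v : R) (k : int) : Num.min (f a) (f b) <= v <= Num.max (f a) (f b) ->
    v = 2 * pi * k%:~R + pi -> False.
  move=> /(IVT ab wf)[c]; rewrite in_itv => /= /fZ[l ->].
  move=> <- /eqP; rewrite -subr_eq addrC -subr_eq0 -addrA.
  move=> /eqP E; have : (2 * (l - k) - 1)%:~R = 0 :> R.
    apply: (mulfI (lt0r_neq0 pi0)); rewrite mulr0 -E !(intrB, intrM, intrD); ring.
  move=> /eqP; rewrite intr_eq0 => /eqP; lia.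
apply/eqP/negPn/negP => fab.
have [nm|mn|nm] := ltgtP n m; last by rewrite fa fb nm eqxx in fab.
  apply: (key (2 * pi * n%:~R + pi) n) => //.
  have : n%:~R + 1 <= m%:~R :> R by rewrite -(intrD _ n 1) ler_int; lia.
  by rewrite fa fb ge_min le_max => h; apply/andP; split; apply/orP; [left|right]; nra.
apply: (key (2 * pi * m%:~R + pi) m) => //.
have : m%:~R + 1 <= n%:~R :> R by rewrite -(intrD _ m 1) ler_int; lia.
by rewrite fa fb ge_min le_max => h; apply/andP; split; apply/orP; [right|left]; nra.
Qed.

End Lift.

Section Turn.
Variable R : realType.
Implicit Types (c d : R -> R * R) (th : R -> R).

(** Continuity is that of a function on the whole line, also at the endpoints 0 and 1, so that lifts
    combine without passing to subspaces. *)
Definition is_lift c th := (forall t, unit_itv t -> {for t, continuous th}) /\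
  forall t, unit_itv t -> polar (c t) (th t).

(* [2 * pi] times the winding number around the origin when [c] is a loop;
   the junk value [0] when [c] has no lift. *)
Definition turn c : R := xget 0 [set w | exists2 th, is_lift c th & w = th 1 - th 0].

Definition nzpath c := continuous c /\ forall t, unit_itv t -> c t != 0.
Definition loop c := nzpath c /\ c 1 = c 0.

(** Two lifts differ by a continuous function whose values are multiples of 2 pi. Subintervals are
    allowed so that one lift can be compared with different explicit arguments on different
    pieces. *)
Lemma lift_diff c th1 th2 a b : 0 <= a -> a <= b -> b <= 1 ->
  (forall t, a <= t <= b -> {for t, continuous th1}) ->
  (forall t, a <= t <= b -> {for t, continuous th2}) ->
  (forall t, a <= t <= b -> polar (c t) (th1 t)) ->
  (forall t, a <= t <= b -> polar (c t) (th2 t)) ->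
  (forall t, a <= t <= b -> c t != 0) ->
  th1 b - th1 a = th2 b - th2 a.
Proof.
move=> a0 ab b1 c1 c2 p1 p2 c0.
have := @int_const _ (fun t => th1 t - th2 t) a b ab.
suff H : th1 a - th2 a = th1 b - th2 b -> th1 b - th1 a = th2 b - th2 a.
  move=> h; apply: H; apply: h => t tab.
    by apply: cvgB; [exact: c1|exact: c2].
  exact: polar_uniq (c0 t tab) (p1 t tab) (p2 t tab).
by lra.
Qed.

Lemma turnE c th : nzpath c -> is_lift c th -> turn c = th 1 - th 0.
Proof.
move=> [_ c0] [lc lp]; rewrite /turn; case: xgetP => [w _ [th' [lc' lp'] ->]|].
  exact: (@lift_diff c th' th 0 1).
by move=> /(_ (th 1 - th 0)) []; exists th.
Qed.

Lemma nzpath_lift c : nzpath c -> exists2 th, is_lift c th & turn c = th 1 - th 0.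
Proof.
move=> pc; have [cc c0] := pc.
have [th [h1 h2]] := lift_ex (@compact_unit R) (@unit0 R) cc c0 (@unit_star R).
by exists th; [split|apply: turnE pc _; split].
Qed.

(** Evaluates the lift of [lift_sum] at 1 and at 0; that construction asks for small steps on the
    ray to every [x], not only to 1. *)
Lemma turn_sum c N : nzpath c -> (0 < N)%N ->
  (forall x k, unit_itv x -> (k < N)%N ->
     0 < dot (c ((k%:R / N%:R) * x)) (c ((k.+1%:R / N%:R) * x))) ->
  turn c = \sum_(k < N) ang (c (k%:R / N%:R)) (c (k.+1%:R / N%:R)).
Proof.
move=> pc N0 d; have [cc c0] := pc.
have [a pa] := polar_ex (c 0).
have /(turnE pc) -> := lift_sum N0 cc c0 (@unit_star R) d pa.
rewrite opprD addrACA subrr add0r.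
(* At parameter 0 all points of the ray coincide and every angle is 0. *)
rewrite [X in _ - X]big1 ?subr0 => [|k _]; last by rewrite !scaler0 ang_self.
by apply: eq_bigr => k _; rewrite /GRing.scale /= !mulr1.
Qed.

Lemma turn_int c : loop c -> exists n : int, turn c = 2 * pi * n%:~R.
Proof.
move=> [pc c10]; have [th [_ lp] ->] := nzpath_lift pc.
apply: (polar_uniq (u := c 0)); first by have [_] := pc; apply; exact: unit0.
  by rewrite -c10; apply: lp; exact: unit1.
by apply: lp; exact: unit0.
Qed.

Lemma nzpath_mul c d : nzpath c -> nzpath d -> nzpath (fun t => cmul (c t) (d t)).
Proof.
move=> [cc c0] [cd d0]; split=> [t|t t01]; first exact: (cont_cmul (cc t) (cd t)).
by rewrite cmul_neq0 ?c0 ?d0.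
Qed.

Lemma turn_mul c d : nzpath c -> nzpath d ->
  turn (fun t => cmul (c t) (d t)) = turn c + turn d.
Proof.
move=> pc pd; have [th1 [l1 p1] ->] := nzpath_lift pc.
have [th2 [l2 p2] ->] := nzpath_lift pd.
rewrite (turnE (th := fun t => th1 t + th2 t) (nzpath_mul pc pd)); first by ring.
split=> t t01; first by apply: cvgD; [exact: l1|exact: l2].
by apply: polar_mul; [exact: p1|exact: p2].
Qed.

Lemma nzpath_opp c : nzpath c -> nzpath (fun t => - c t).
Proof.
move=> [cc c0]; split=> [t|t t01]; first by apply: cvgN; exact: cc.
by rewrite oppr_eq0 c0.
Qed.

Lemma turn_opp c : nzpath c -> turn (fun t => - c t) = turn c.
Proof.
move=> pc; have [th1 [l1 p1] ->] := nzpath_lift pc.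
rewrite (turnE (th := fun t => th1 t + pi) (nzpath_opp pc)); first by ring.
split=> t t01; first by apply: cvgD; [exact: l1|exact: cvg_cst].
by apply: polarN; exact: p1.
Qed.

Definition conjp (u : R * R) : R * R := (u.1, - u.2).

Lemma polar_conj (u : R * R) a : polar u a -> polar (conjp u) (- a).
Proof.
rewrite /polar /cmod /= sqrrN cosN sinN => {1}->; rewrite /conjp /=.
by rewrite mulrN.
Qed.

Lemma nzpath_conj c : nzpath c -> nzpath (fun t => conjp (c t)).
Proof.
move=> [cc c0]; split=> [t|t t01].
  by apply: (cont_pair (cont_fst (cc t))); apply: cvgN; exact: (cont_snd (cc t)).
by rewrite pair_eq0 /= oppr_eq0 -pair_eq0 c0.
Qed.

Lemma turn_conj c : nzpath c -> turn (fun t => conjp (c t)) = - turn c.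
Proof.
move=> pc; have [th1 [l1 p1] ->] := nzpath_lift pc.
rewrite (turnE (th := fun t => - th1 t) (nzpath_conj pc)); first by ring.
split=> t t01; first by apply: cvgN; exact: l1.
by apply: polar_conj; exact: p1.
Qed.

Lemma turn_slit c : continuous c -> c 1 = c 0 ->
  (forall t, unit_itv t -> 0 < cmod (c t) + (c t).1) -> turn c = 0.
Proof.
move=> cc c10 s; rewrite (@turnE c (fun t => carg (c t))); first by rewrite c10 subrr.
  split=> // t /s; rewrite cmod_slit pair_eq0 negb_and => /orP[->|/lt0r_neq0 ->//].
  by rewrite orbT.
split=> t t01; first by apply: cont_carg; [exact: cc|exact: s].
by apply: polar_carg; exact: s.
Qed.

Lemma square_lift (F : R * R -> R * R) : continuous F ->
  (forall x, square x -> F x != 0) ->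
  exists2 Th : R * R -> R, (forall x, square x -> {for x, continuous Th}) &
    forall p : R -> R * R, continuous p -> (forall t, unit_itv t -> square (p t)) ->
      turn (F \o p) = Th (p 1) - Th (p 0).
Proof.
move=> cF F0.
have [Th [h1 h2]] := lift_ex (@compact_square R) (conj (@unit0 R) (@unit0 R)) cF F0 (@square_star R).
exists Th => // p cp sp; apply: (@turnE _ (Th \o p)).
  split=> [t|t t01]; first by apply: continuous_comp; [exact: cp|exact: cF].
  by apply: F0; exact: sp.
split=> t t01; first by apply: continuous_comp; [exact: cp|apply: h1; exact: sp].
by apply: h2; exact: sp.
Qed.

(** The turning of the loop at [s] is an increment of one lift on the square, hence continuous in
    [s]; it is also a multiple of 2 pi. *)
Lemma turn_homotopy (F : R * R -> R * R) : continuous F ->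
  (forall x, square x -> F x != 0) ->
  (forall s, unit_itv s -> F (s, 1) = F (s, 0)) ->
  turn (fun t => F (0, t)) = turn (fun t => F (1, t)).
Proof.
move=> cF F0 FF; have [Th cTh turnTh] := square_lift cF F0.
have ct s : turn (fun t => F (s, t)) = turn (F \o (fun t => (s, t))) by [].
have E s : unit_itv s -> turn (fun t => F (s, t)) = Th (s, 1) - Th (s, 0).
  move=> s01; rewrite ct turnTh// => t.
  by apply: cont_pair; [exact: cvg_cst|exact: cvg_id].
rewrite (E 0 (@unit0 R)) (E 1 (@unit1 R)).
apply: (@int_const _ (fun s => Th (s, 1) - Th (s, 0))) => // s s01.
  apply: cvgB; apply: (@continuous_comp _ _ _ (fun s : R => (s, _ : R))).
  - by apply: cont_pair; [exact: cvg_id|exact: cvg_cst].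
  - by apply: cTh; split=> //; exact: unit1.
  - by apply: cont_pair; [exact: cvg_id|exact: cvg_cst].
  - by apply: cTh; split=> //; exact: unit0.
rewrite -E//; apply: turn_int; split; last exact: FF.
split=> t; last by move=> t01; exact: F0.
apply: (@continuous_comp _ _ _ (fun t : R => (s, t))); last exact: cF.
by apply: cont_pair; [exact: cvg_cst|exact: cvg_id].
Qed.

(** The diagonal has the same endpoints as the bottom side followed by the right side, and one lift
    on the square computes all three turnings from endpoints. *)
Lemma turn_diag (F : R * R -> R * R) : continuous F ->
  (forall x, square x -> F x != 0) ->
  turn (fun t => F (t, t)) = turn (fun t => F (t, 0)) + turn (fun t => F (1, t)).
Proof.
move=> cF F0; have [Th cTh turnTh] := square_lift cF F0.
have := turnTh (fun t => (t, t)); rewrite /comp => ->; last 2 first.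
  by move=> t; apply: cont_pair; exact: cvg_id.
  by move=> t t01; split.
have := turnTh (fun t => (t, 0)); rewrite /comp => ->; last 2 first.
  by move=> t; apply: cont_pair; [exact: cvg_id|exact: cvg_cst].
  by move=> t t01; split => //; exact: unit0.
have := turnTh (fun t => (1, t)); rewrite /comp => ->; last 2 first.
  by move=> t; apply: cont_pair; [exact: cvg_cst|exact: cvg_id].
  by move=> t t01; split => //; exact: unit1.
by ring.
Qed.

End Turn.

(** * Reduction to winding numbers of points *)

Section Grid.
Variable R : realType.
Implicit Types (u v w z : R * R).

Lemma norm_pair_lt u (d : R) : (`|u| < d) = (`|u.1| < d) && (`|u.2| < d).
Proof. by rewrite prod_normE gt_max. Qed.

Lemma norm_pair_le u (d : R) : (`|u| <= d) = (`|u.1| <= d) && (`|u.2| <= d).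
Proof. by rewrite prod_normE ge_max. Qed.

Lemma carg_i (c : R) : 0 < c -> carg (0, c) = pi / 2.
Proof.
move=> c0; rewrite /carg /cmod /= expr0n add0r addr0 sqrtr_sqr gtr0_norm//.
by rewrite divff ?lt0r_neq0// atan1; field.
Qed.

(** All four vectors lie in the closed half-plane of [e], where each angle is a difference of angles
    measured from [e]; these cancel around the quadrilateral. *)
Lemma ang_quad (e a b c d : R * R) : e != 0 -> a != 0 -> b != 0 -> c != 0 -> d != 0 ->
  0 <= dot e a -> 0 <= dot e b -> 0 <= dot e c -> 0 <= dot e d ->
  0 <= dot a b -> 0 <= dot b c -> 0 <= dot d c -> 0 <= dot a d ->
  ang a b + ang b c - ang d c - ang a d = 0.
Proof.
move=> e0 a0 b0 c0 d0 ea eb ec ed ab bc dc ad.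
have := ang_cocycle e0 a0 b0 ea ab eb.
have := ang_cocycle e0 b0 c0 eb bc ec.
have := ang_cocycle e0 d0 c0 ed dc ec.
have := ang_cocycle e0 a0 d0 ea ad ed.
lra.
Qed.

(** In a coordinate where [w] is at least 7 d in absolute value, [u] and [v] have the same sign and
    exceed 5 d in size, contributing more than 25 d^2. In the other coordinate they differ by less
    than 4 d, so that product is at least -4 d^2. *)
Lemma dot_far d u v w : 0 < d -> 7 * d <= `|w| -> `|w - u| < 2 * d ->
  `|w - v| < 2 * d -> 0 < dot u v.
Proof.
move=> d0; rewrite !norm_pair_lt /= !ltr_norml => wd /andP[/andP[? ?] /andP[? ?]]
  /andP[/andP[? ?] /andP[? ?]].
have : 7 * d <= `|w.1| \/ 7 * d <= `|w.2|.
  by apply/orP; move: wd; rewrite prod_normE le_max.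
rewrite /dot.
have h (x y p q : R) : 0 < d -> -(4*d) < x - y < 4*d -> (5 * d < p /\ 5 * d < q \/ p < - (5 * d) /\ q < - (5 * d)) -> 0 < p * q + x * y.
  move=> _ /andP[? ?] pq.
  have : - (4 * d ^+ 2) <= x * y.
    have : 0 <= (x + y) ^+ 2 by exact: sqr_ge0.
    have : (x - y) ^+ 2 <= 16 * d ^+ 2 by nra.
    nra.
  have : 25 * d ^+ 2 < p * q by case: pq => -[? ?]; nra.
  have : 0 < d ^+ 2 by rewrite exprn_gt0.
  lra.
move=> [|]; rewrite ler_normr => /orP[?|?].
- by apply: h => //; [apply/andP; split; lra | left; split; lra].
- by apply: h => //; [apply/andP; split; lra | right; split; lra].
- by rewrite addrC; apply: h => //; [apply/andP; split; lra | left; split; lra].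
- by rewrite addrC; apply: h => //; [apply/andP; split; lra | right; split; lra].
Qed.

(** The primitive sums [h] along the bottom row and then [v] up the column; closedness of the cells
    below an edge gives the increment along it. *)
Lemma discrete_poincare (n : nat) (h v : nat -> nat -> R) :
  (forall i j, (i < n)%N -> (j < n)%N -> h i j + v i.+1 j - h i j.+1 - v i j = 0) ->
  exists phi : nat -> nat -> R,
    (forall i j, phi i j.+1 - phi i j = v i j) /\
    (forall i j, (i < n)%N -> (j <= n)%N -> phi i.+1 j - phi i j = h i j).
Proof.
move=> hv; exists (fun i j => \sum_(a < i) h a 0 + \sum_(b < j) v i b); split=> [i j|i j ni].
  by rewrite big_ord_recr /=; ring.
elim: j => [|j IH] nj; first by rewrite big_ord_recr /= !big_ord0; ring.
rewrite [X in _ + X - _]big_ord_recr [X in _ - (_ + X)]big_ord_recr /=.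
have := hv i j ni nj; have := IH (ltnW nj); lra.
Qed.

Section GridPoints.
Variables (x0 d : R).
Hypothesis d0 : 0 < d.

Definition gridpt (i j : nat) : R * R := (x0 + i%:R * d, x0 + j%:R * d).
Definition center (i j : nat) : R * R := (x0 + (i%:R + 1 / 2) * d, x0 + (j%:R + 1 / 2) * d).

(** The angles of [f] summed counterclockwise around the square with lower left vertex (i, j); the
    last two edges are traversed backwards. *)
Definition curl (f : R * R -> R * R) (i j : nat) : R :=
  ang (f (gridpt i j)) (f (gridpt i.+1 j)) + ang (f (gridpt i.+1 j)) (f (gridpt i.+1 j.+1))
  - ang (f (gridpt i j.+1)) (f (gridpt i.+1 j.+1)) - ang (f (gridpt i j)) (f (gridpt i j.+1)).

Lemma curl_center i j : curl (fun z => z - center i j) i j = 2 * pi.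
Proof.
have E : [/\ gridpt i j - center i j = (- (d/2), - (d/2)),
  gridpt i.+1 j - center i j = (d/2, - (d/2)),
  gridpt i j.+1 - center i j = (- (d/2), d/2) &
  gridpt i.+1 j.+1 - center i j = (d/2, d/2)].
  by rewrite /gridpt /center; split; (apply/eqP; rewrite -subr_eq0; apply/eqP;
   congr pair; rewrite /= -?natr1; field).
rewrite /curl; case: E => -> -> -> ->.
rewrite /ang /dot /crs /=.
have h : 0 < d ^+ 2 / 2 by rewrite divr_gt0// exprn_gt0.
have -> : (- (d / 2) * (d / 2) + - (d / 2) * - (d / 2), - (d / 2) * - (d / 2) - - (d / 2) * (d / 2)) = (0, d ^+ 2 / 2) by congr pair; field.
have -> : (d / 2 * (d / 2) + - (d / 2) * (d / 2), d / 2 * (d / 2) - - (d / 2) * (d / 2)) = (0, d ^+ 2 / 2) by congr pair; field.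
have -> : (- (d / 2) * (d / 2) + d / 2 * (d / 2), - (d / 2) * (d / 2) - d / 2 * (d / 2)) = (0, - (d ^+ 2 / 2)) by congr pair; field.
have -> : (- (d / 2) * - (d / 2) + - (d / 2) * (d / 2), - (d / 2) * (d / 2) - - (d / 2) * - (d / 2)) = (0, - (d ^+ 2 / 2)) by congr pair; field.
by rewrite carg_conj carg_i//; field.
Qed.

(** Seen from the centre of a different square, the four vertices lie in one half-plane orthogonal
    to a coordinate direction. *)
Lemma curl_other i j k l : (i, j) != (k, l) -> curl (fun z => z - center k l) i j = 0.
Proof.
move=> ne.
pose f a b : R * R := ((a%:~R - 1 / 2) * d, (b%:~R - 1 / 2) * d).
have fE a b : gridpt a b - center k l = f (Posz a - Posz k) (Posz b - Posz l).
  by rewrite /gridpt /center /f !intrB; apply/eqP; rewrite -subr_eq0; apply/eqP;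
   congr pair; rewrite /=; field.
have [p ep] : exists p : int, p = Posz i - Posz k by eexists.
have [q eq] : exists q : int, q = Posz j - Posz l by eexists.
have Si a b : (Posz a.+1 - Posz b = (Posz a - Posz b) + 1) by lia.
rewrite /curl !fE !Si -ep -eq.
(* For an integer a, a (a - 1) >= 0. So each vertex is at least d / 2 away from the centre in both
   coordinates, and adjacent vertices are seen under at most a right angle. *)
have sq (a : int) : d ^+ 2 / 4 <= ((a%:~R - 1 / 2) * d) ^+ 2.
  have : 0 <= (a%:~R * (a%:~R - 1)) :> R.
    have -> : a%:~R * (a%:~R - 1) = (a * (a - 1))%:~R :> R by rewrite intrM intrB.
    by rewrite ler0z; nia.
  have : 0 < d ^+ 2 by rewrite exprn_gt0.
  nra.
have dd : 0 < d ^+ 2 by rewrite exprn_gt0.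
have f0 a b : f a b != 0.
  rewrite -dot_gt0 /dot -!expr2; have := sq a; have := sq b; rewrite /f /=; lra.
have fh a b : 0 <= dot (f a b) (f (a + 1) b).
  by rewrite /dot /f /= intrD; have := sq b; nra.
have fv a b : 0 <= dot (f a b) (f a (b + 1)).
  by rewrite /dot /f /= intrD; have := sq a; nra.
have half_neg (x y : R) : 0 < y -> (x + 1) * y <= 0 ->
    (x - 1 / 2) * y <= 0 /\ (x + 1 - 1 / 2) * y <= 0 by clear => *; lra.
have half_pos (x y : R) : 0 < y -> 1 * y <= x * y ->
    0 <= (x - 2^-1) * y /\ 0 <= (x + 1 - 2^-1) * y by clear => *; lra.
suff [e [e0 [e1 e2 e3 e4]]] : exists e : R * R, e != 0 /\ [/\ 0 <= dot e (f p q),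
   0 <= dot e (f (p + 1) q), 0 <= dot e (f p (q + 1)) & 0 <= dot e (f (p + 1) (q + 1))].
  by rewrite (ang_quad e0 (f0 p q) (f0 (p+1) q) (f0 (p+1) (q+1)) (f0 p (q + 1))).
have [p0|p0|p0] := ltgtP p 0.
- exists (-1, 0); split; first by rewrite pair_eq0 /= oppr_eq0 oner_eq0.
  have h : (p%:~R + 1) * d <= 0.
    by rewrite mulr_le0_ge0 ?(ltW d0)// -(intrD _ p 1) lerz0; lia.
  by split; rewrite /dot /f /= ?intrD ?mulr1z !mul0r !addr0 !mulN1r oppr_ge0; have [] := half_neg _ _ d0 h.
- exists (1, 0); split; first by rewrite pair_eq0 /= oner_eq0.
  have h : 1 * d <= p%:~R * d by rewrite ler_pM2r// ler1z; lia.
  by split; rewrite /dot /f /= ?intrD ?mulr1z !mul0r !addr0 !mul1r; have [] := half_pos _ _ d0 h.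
have [q0|q0|q0] := ltgtP q 0.
- exists (0, -1); split; first by rewrite pair_eq0 /= oppr_eq0 oner_eq0 andbF.
  have h : (q%:~R + 1) * d <= 0.
    by rewrite mulr_le0_ge0 ?(ltW d0)// -(intrD _ q 1) lerz0; lia.
  by split; rewrite /dot /f /= ?intrD ?mulr1z !mul0r !add0r !mulN1r oppr_ge0; have [] := half_neg _ _ d0 h.
- exists (0, 1); split; first by rewrite pair_eq0 /= oner_eq0 andbF.
  have h : 1 * d <= q%:~R * d by rewrite ler_pM2r// ler1z; lia.
  by split; rewrite /dot /f /= ?intrD ?mulr1z !mul0r !add0r !mul1r; have [] := half_pos _ _ d0 h.
by move: ne; rewrite xpair_eqE => /negP[]; apply/andP; split; apply/eqP; lia.
Qed.

End GridPoints.

Lemma unif_cont_unit (G : R -> R * R) (d : R) : continuous G -> 0 < d ->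
  exists2 e : R, 0 < e & forall y, unit_itv y -> forall a, `|y - a| < e -> `|G y - G a| < d.
Proof.
move=> cG d0; apply: (compact_right (P := fun e y => forall a, `|y - a| < e -> `|G y - G a| < d)).
  exact: compact_unit.
move=> x _; have d2 : 0 < d / 2 by rewrite divr_gt0.
have /cvgrPdist_lt /(_ _ d2) /nbhs_ballP[r /= r0 rP] := cG x.
exists (r / 2); first by rewrite divr_gt0.
move=> y e xy /andP[e0 er] a ya.
have h b : `|x - b| < r -> `|G x - G b| < d / 2 by move=> hb; apply: rP; rewrite -ball_normE.
have -> : G y - G a = (G x - G a) - (G x - G y) by rewrite opprB [RHS]addrC addrA subrK.
have hy := h y ltac:(lra).
have /h ha : `|x - a| < r.
  have -> : x - a = (x - y) + (y - a) by rewrite addrA subrK.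
  by rewrite (le_lt_trans (ler_normD _ _))//; lra.
by rewrite (le_lt_trans (ler_normB _ _))//; lra.
Qed.

Lemma cell_lt (x0 d x x' : R) (i i' : nat) : 0 < d ->
  x0 + i%:R * d <= x < x0 + i%:R * d + d -> x0 + i'%:R * d <= x' < x0 + i'%:R * d + d ->
  - d < x - x' < d ->
  [/\ - (2 * d) < x - (x0 + i%:R * d) < 2 * d, - (2 * d) < x - (x0 + i'%:R * d) < 2 * d
    & i' = i \/ i' = i.+1 \/ i = i'.+1].
Proof.
move=> d0 /andP[? ?] /andP[? ?] /andP[? ?].
have lt2 (a b : nat) : a%:R * d < b%:R * d + 2 * d -> (a <= b.+1)%N.
  by rewrite -mulrDl ltr_pM2r// -natrD ltr_nat; lia.
split; first by apply/andP; split; lra.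
  by apply/andP; split; lra.
have : (i <= i'.+1)%N by apply: lt2; lra.
have : (i' <= i.+1)%N by apply: lt2; lra.
clear; lia.
Qed.

(** The primitive at [z] is the discrete one at the lower left vertex of the cell of [z], plus [C]
    from that vertex to [z]. For close [z] and [z'] all points involved are within 2 d of [z], where
    [C] is additive. *)
Lemma grid_primitive (K : set (R * R)) (C : R * R -> R * R -> R) (B d : R) (n : nat) :
  0 < d -> 0 < B -> (forall z, K z -> `|z| <= B) -> ((Num.truncn (2 * B / d)).+2 <= n)%N ->
  (forall a b, C b a = - C a b) ->
  (forall k a b c, K k -> `|k - a| < 2 * d -> `|k - b| < 2 * d -> `|k - c| < 2 * d ->
    C a b + C b c = C a c) ->
  (forall i j, (i < n)%N -> (j < n)%N ->
    C (gridpt (- B) d i j) (gridpt (- B) d i.+1 j)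
    + C (gridpt (- B) d i.+1 j) (gridpt (- B) d i.+1 j.+1)
    - C (gridpt (- B) d i j.+1) (gridpt (- B) d i.+1 j.+1)
    - C (gridpt (- B) d i j) (gridpt (- B) d i j.+1) = 0) ->
  exists g : R * R -> R, forall z z', K z -> K z' -> `|z - z'| < d -> C z z' = g z' - g z.
Proof.
move=> d0 B0 KB nB CC C_cocycle curl0; set P := gridpt (- B) d in curl0.
have C_self a : C a a = 0 by have := CC a a; lra.
have [phi [phiv phih]] := discrete_poincare curl0.
pose ix (x : R) := Num.truncn ((x + B) / d).
have ixP x : `|x| <= B -> (ix x < n)%N /\ - B + (ix x)%:R * d <= x < - B + (ix x)%:R * d + d.
  rewrite ler_norml => /andP[x1 x2].
  have x0 : 0 <= (x + B) / d by rewrite divr_ge0 ?(ltW d0)//; lra.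
  split.
    apply: leq_trans nB; rewrite ltnS; apply: leqW.
    by rewrite le_truncn// ler_pM2r ?invr_gt0//; lra.
  have := truncn_itv x0; rewrite -/(ix x) ler_pdivlMr// ltr_pdivrMr// -natr1 => /andP[? ?].
  by apply/andP; split; lra.
pose v z := P (ix z.1) (ix z.2).
exists (fun z => phi (ix z.1) (ix z.2) + C (v z) z) => z z' Kz Kz' zz'.
have := KB z Kz; rewrite norm_pair_le => /andP[/ixP[n1 b1] /ixP[n2 b2]].
have := KB z' Kz'; rewrite norm_pair_le => /andP[/ixP[n1' b1'] /ixP[n2' b2']].
have := zz'; rewrite norm_pair_lt /= !ltr_norml => /andP[a1 a2].
have [zv1 zv1' adj1] := cell_lt d0 b1 b1' a1.
have [zv2 zv2' adj2] := cell_lt d0 b2 b2' a2.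
(* The vertex in the column of [z'] and the row of [z]: through it the two cell vertices are joined
   by at most one horizontal and one vertical grid step. *)
pose u := P (ix z'.1) (ix z.2).
have zv : `|z - v z| < 2 * d by rewrite norm_pair_lt /= !ltr_norml zv1.
have zv' : `|z - v z'| < 2 * d by rewrite norm_pair_lt /= !ltr_norml zv1'.
have zu : `|z - u| < 2 * d by rewrite norm_pair_lt /= !ltr_norml zv1'.
have d2 : d < 2 * d by clear -d0; lra.
have zz : `|z - z| < 2 * d by rewrite subrr normr0; exact: lt_trans d2.
have zz2 : `|z - z'| < 2 * d by exact: lt_trans d2.
have c1 := C_cocycle z (v z) z z' Kz zv zz zz2.
have c2 := C_cocycle z (v z) (v z') z' Kz zv zv' zz2.
have c3 := C_cocycle z (v z) u (v z') Kz zv zu zv'.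
have cu : C (v z) u = phi (ix z'.1) (ix z.2) - phi (ix z.1) (ix z.2).
  rewrite /u /v; case: adj1 => [|[]] ->.
  - by rewrite C_self subrr.
  - by rewrite phih// ltnW.
  - by rewrite CC -phih ?opprB// ltnW.
have cv : C u (v z') = phi (ix z'.1) (ix z'.2) - phi (ix z'.1) (ix z.2).
  rewrite /u /v; case: adj2 => [|[]] ->.
  - by rewrite C_self subrr.
  - by rewrite phiv.
  - by rewrite CC -phiv opprB.
clear -c1 c2 c3 cu cv; lra.
Qed.

(* On the vertices of a fine grid, subtract from the angle cochain of [V] those
   of [z - q i], for [q i] the centers of the squares, weighted by the curls of
   [V]: the difference is closed on the whole grid, hence exact, and a primitive
   extends to [K], where all these cochains satisfy the cocycle identity. The
   weights [m i] need not be integers. *)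
Lemma turn_grid (K : set (R * R)) (V : R * R -> R * R) : compact K ->
  (forall z, K z -> {for z, continuous V}) -> (forall z, K z -> V z != 0) ->
  exists (I : finType) (m : I -> R) (q : I -> R * R),
    (forall i, m i != 0 -> ~ K (q i)) /\
    forall G : R -> R * R, continuous G -> G 1 = G 0 -> (forall t, K (G t)) ->
      turn (V \o G) = \sum_i m i * turn (fun t => G t - q i).
Proof.
move=> cK cV V0.
have [e e0 eP] := unif_dot cK cV V0.
have [M [_ /(_ (`|M| + 1) ltac:(by rewrite (le_lt_trans (ler_norm _))// ltrDl))]] := compact_bounded cK.
set B := `|M| + 1 => KB; have B0 : 0 < B by rewrite ltr_wpDl.
pose d := e / 8; have d0 : 0 < d by rewrite divr_gt0.
have ed : e = 8 * d by rewrite /d; field.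
pose n := (Num.truncn (2 * B / d)).+2.
pose P := gridpt (- B) d; pose Q (p : 'I_n * 'I_n) := center (- B) d p.1 p.2.
pose m (p : 'I_n * 'I_n) := curl (- B) d V p.1 p.2 / (2 * pi).
have pi0 : 0 < 2 * pi :> R by rewrite mulr_gt0 ?pi_gt0.
(* If the centre were closer than 7 d to a point of [K], the four vertices would be within 8 d = e
   of it, the values of [V] there would have positive dot products, and the curl would be 0. This,
   with the 7 d of [dot_far], is the origin of d = e / 8. *)
have mQ p k : m p != 0 -> K k -> 7 * d <= `|k - Q p|.
  move=> mp Kk; rewrite leNgt; apply/negP => kq; move/eqP: mp; apply.
  rewrite /m; have hk (a : R * R) : `|Q p - a| <= d -> `|k - a| < e.
    move=> qa; have -> : k - a = (k - Q p) + (Q p - a) by rewrite addrA subrK.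
    by rewrite (le_lt_trans (ler_normD _ _))//; lra.
  have hc (x y : R) : x = y \/ x = y + 1 -> `|- B + (y + 1 / 2) * d - (- B + x * d)| <= d.
    by rewrite ler_norml => -[->|->]; apply/andP; split; lra.
  have cor i j : i%:R = p.1%:R :> R \/ i%:R = p.1%:R + 1 :> R ->
      j%:R = p.2%:R :> R \/ j%:R = p.2%:R + 1 :> R -> `|k - P i j| < e.
    by move=> hi hj; apply: hk; rewrite norm_pair_le /= !hc.
  have l1 x : x%:R = x%:R :> R \/ x%:R = x%:R + 1 :> R by left.
  have l2 (x : nat) : x.+1%:R = x%:R :> R \/ x.+1%:R = x%:R + 1 :> R by right; rewrite natr1.
  have [Ka Kb Kc Kd] : [/\ `|k - P p.1 p.2| < e, `|k - P p.1.+1 p.2| < e,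
      `|k - P p.1.+1 p.2.+1| < e & `|k - P p.1 p.2.+1| < e] by split; apply: cor.
  have dotV a b : `|k - a| < e -> `|k - b| < e -> 0 <= dot (V a) (V b).
    by move=> ha hb; apply/ltW/(eP k Kk).
  have nz a : `|k - a| < e -> V a != 0.
    by move=> ha; rewrite -dot_gt0; apply: (eP k Kk).
  by rewrite /curl -/P (ang_quad (nz _ Ka) (nz _ Ka) (nz _ Kb) (nz _ Kc) (nz _ Kd)) ?mul0r ?dotV.
pose C a b := ang (V a) (V b) - \sum_p m p * ang (a - Q p) (b - Q p).
have CC a b : C b a = - C a b.
  rewrite /C angC opprB addrC; congr (_ + _).
  by rewrite -sumrN; apply: eq_bigr => p _; rewrite angC mulrN opprK.
have C_cocycle k a b c : K k -> `|k - a| < 2 * d -> `|k - b| < 2 * d ->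
    `|k - c| < 2 * d -> C a b + C b c = C a c.
  move=> Kk ka kb kc; rewrite /C.
  have V_dot x y : `|k - x| < 2 * d -> `|k - y| < 2 * d -> 0 < dot (V x) (V y).
    by move=> kx ky; apply: eP Kk _ _ _ _; lra.
  have nz x : `|k - x| < 2 * d -> V x != 0 by move=> kx; rewrite -dot_gt0 V_dot.
  rewrite -(@ang_cocycle _ (V a) (V b) (V c)) ?nz ?ltW ?V_dot//.
  rewrite addrACA -opprD -big_split /=; congr (_ - _); apply: eq_bigr => p _.
  rewrite -mulrDr; have [->|mp] := eqVneq (m p) 0; first by rewrite !mul0r.
  have Qd x y : `|k - x| < 2 * d -> `|k - y| < 2 * d -> 0 < dot (x - Q p) (y - Q p).
    move=> kx ky; apply: (dot_far d0 (mQ p k mp Kk)).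
      by rewrite opprB addrA subrK.
    by rewrite opprB addrA subrK.
  have nzQ x : `|k - x| < 2 * d -> x - Q p != 0 by move=> kx; rewrite -dot_gt0 Qd.
  by rewrite ang_cocycle ?nzQ ?ltW ?Qd.
have [g step] : exists g : R * R -> R, forall z z', K z -> K z' -> `|z - z'| < d ->
    C z z' = g z' - g z.
  apply: (grid_primitive d0 B0 KB (leqnn n) CC C_cocycle) => i j ni nj.
  rewrite /C; set s1 := \sum_p _; set s2 := \sum_p _; set s3 := \sum_p _; set s4 := \sum_p _.
  have E : s1 + s2 - s3 - s4 = curl (- B) d V i j.
    rewrite -big_split /= -!sumrB.
    transitivity (\sum_p m p * curl (- B) d (fun z => z - Q p) i j).
      by apply: eq_bigr => p _; rewrite /curl; ring.
    (* Among all centres only that of the square itself has nonzero curl on it, namely the 2 pi by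
       which [m] was divided. *)
    rewrite (bigD1 (Ordinal ni, Ordinal nj))//= big1 => [|p pij].
      by rewrite addr0 (curl_center (- B) d0 i j) divfK// lt0r_neq0.
    rewrite /Q curl_other ?mulr0//; apply: contra pij => /eqP[e1 e2].
    by rewrite -pair_eqE /= -!val_eqE /= e1 e2 !eqxx.
  by move: E; rewrite /curl; lra.
exists ('I_n * 'I_n)%type, m, Q; split=> [p mp Kq|G cG G10 KG].
  by have := mQ p _ mp Kq; rewrite subrr normr0; lra.
have [r r0 rG] := unif_cont_unit cG d0.
have [N N0 GN] := @fine_steps R R _ (fun y a => `|G y - G a| < d) r (@compact_unit R) r0 (@unit_star R) rG.
have pV : nzpath (V \o G).
  by split=> [t|t _]; [apply: continuous_comp; [exact: cG|exact: cV]|exact: V0].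
rewrite (turn_sum pV N0); last first.
  move=> x k x01 kN; apply: (eP _ (KG (k%:R / N%:R * x))); first by rewrite subrr normr0.
  by apply: (lt_le_trans (GN x k x01 kN)); lra.
pose z k := G (k%:R / N%:R).
have -> : \sum_p m p * turn (fun t => G t - Q p) =
    \sum_p \sum_(k < N) m p * ang (z k - Q p) (z k.+1 - Q p).
  apply: eq_bigr => p _; have [->|mp] := eqVneq (m p) 0.
    by rewrite mul0r big1// => k _; rewrite mul0r.
  rewrite -mulr_sumr; congr (_ * _); apply: turn_sum => //.
    split=> [t|t _]; first by apply: cvgB; [exact: cG|exact: cvg_cst].
    by rewrite subr_eq0; apply/eqP => E; have := mQ p _ mp (KG t); rewrite E subrr normr0; lra.
  move=> x k x01 kN; apply: (dot_far d0 (mQ p _ mp (KG (k%:R / N%:R * x)))).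
    by rewrite opprB addrA subrK subrr normr0; lra.
  by rewrite opprB addrA subrK; have := GN x k x01 kN; rewrite /GRing.scale /=; lra.
(* Both sides are now sums over the steps of [G]; their difference is the sum of [C] over these
   steps, which telescopes around the loop. *)
rewrite exchange_big /=; apply/eqP; rewrite -subr_eq0 -sumrB; apply/eqP.
transitivity (\sum_(k < N) (g (z k.+1) - g (z k))).
  apply: eq_bigr => k _; rewrite -step//; first exact: KG.
    exact: KG.
  by have := GN 1 k (@unit1 R) (ltn_ord k); rewrite /GRing.scale /= !mulr1.
rewrite -(big_mkord xpredT (fun k => g (z k.+1) - g (z k))) telescope_sumr//.
by rewrite /z mul0r divff ?pnatr_eq0 -?lt0n// G10 subrr.
Qed.

End Grid.

(** * Loops meeting the negative real axis once; derivative rules on the line *)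

Section Cross.
Variable R : realType.

Lemma carg_lt0 (u : R * R) : u.2 < 0 -> carg u < 0.
Proof.
move=> u2; have s : 0 < cmod u + u.1 by rewrite cmod_slit lt_eqF.
rewrite /carg pmulr_rlt0// -(atan0 R); apply: lt_atan.
by rewrite pmulr_llt0// invr_gt0.
Qed.

Lemma carg_gt0 (u : R * R) : 0 < u.2 -> 0 < carg u.
Proof.
move=> u2; have s : 0 < cmod u + u.1 by rewrite cmod_slit gt_eqF.
rewrite /carg pmulr_rgt0// -(atan0 R); apply: lt_atan.
by rewrite divr_gt0.
Qed.

Lemma carg_opp (u : R * R) : u.2 < 0 -> carg (- u) = carg u + pi.
Proof.
move=> u2.
have s : 0 < cmod u + u.1 by rewrite cmod_slit lt_eqF.
have s' : 0 < cmod (- u) + (- u).1 by rewrite cmod_slit /= oppr_eq0 lt_eqF.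
have u0 : - u != 0 by rewrite oppr_eq0 pair_eq0 negb_and (lt_eqF u2) orbT.
have [n en] := polar_uniq u0 (polar_carg s') (polarN (polar_carg s)).
have /(int_pi_eq0 en) : `|carg (- u) - (carg u + pi)| < 2 * pi.
  have := carg_lt0 u2; have := @carg_gt0 (- u); rewrite /= oppr_gt0 => /(_ u2).
  have := carg_bound_pi u; have := carg_bound_pi (- u); rewrite !ltr_norml.
  by move=> /andP[? ?] /andP[? ?] ? ?; apply/andP; split; lra.
lra.
Qed.

(** The loop leaves the negative real axis downwards and returns to it from above. On [h, 1 - h] the
    principal argument of r is a lift; on the end pieces that of - r, increased by pi, is one, since
    - r avoids the slit there. The two changes of branch contribute pi each. *)
Lemma turn_cross (r : R -> R * R) (h : R) : continuous r -> r 1 = r 0 ->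
  (r 0).1 < 0 -> (r 0).2 = 0 -> 0 < h < 1 / 2 ->
  (forall t, 0 < t < 1 -> 0 < cmod (r t) + (r t).1) ->
  (forall t, 0 < t <= h -> (r t).2 < 0) ->
  (forall t, 1 - h <= t < 1 -> 0 < (r t).2) -> turn r = 2 * pi.
Proof.
move=> cr r10 r01 r02 /andP[h0 h1] sl lo hi.
have nz t : unit_itv t -> r t != 0.
  move=> /andP[t0 t1]; rewrite pair_eq0 negb_and.
  have e0 : (r 0).1 != 0 by rewrite lt_eqF.
  have [<-|t0'] := eqVneq 0 t; first by rewrite e0.
  have [->|t1'] := eqVneq t 1; first by rewrite r10 e0.
  have := sl t; rewrite !lt_neqAle t0' t0 t1' t1 => /(_ isT).
  by rewrite -lt_neqAle cmod_slit => /orP[->|/gt_eqF ->//]; rewrite orbT.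
have pr : nzpath r by [].
have [th [cth pth] ->] := nzpath_lift pr.
have key (f : R -> R) (a b : R) : 0 <= a -> a <= b -> b <= 1 ->
    (forall t : R, a <= t <= b -> {for t, continuous f}) ->
    (forall t : R, a <= t <= b -> polar (r t) (f t)) -> th b - th a = f b - f a.
  move=> a0 ab b1 cf pf.
  have u t : a <= t <= b -> unit_itv t.
    by move=> /andP[at_ tb]; rewrite /unit_itv /= (le_trans a0 at_) (le_trans tb b1).
  by apply: (lift_diff (c := r)) => // t /u tu; [exact: cth|exact: pth|exact: nz].
have slN t : (r t).2 != 0 \/ t = 0 \/ t = 1 -> 0 < cmod (- r t) + (- r t).1.
  rewrite cmod_slit /= oppr_eq0 oppr_gt0 => -[->//|[]->]; rewrite ?r10 r01 orbT //.
have flip (a b : R) : 0 <= a -> a <= b -> b <= 1 ->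
    (forall t : R, a <= t <= b -> (r t).2 != 0 \/ t = 0 \/ t = 1) ->
    th b - th a = carg (- r b) - carg (- r a).
  move=> a0 ab b1 H; rewrite (key (fun t => carg (- r t) + pi) a b)//; first by ring.
    move=> t /H/slN st; apply: cvgD; last exact: cvg_cst.
    by apply: (@cont_carg R R (fun t => - r t) t _ st); apply: cvgN; exact: cr.
  by move=> t /H/slN st; rewrite -[r t]opprK; apply: polarN; rewrite opprK; apply: polar_carg.
have E1 : th h - th 0 = carg (- r h) - carg (- r 0).
  apply: flip; [by []|exact: ltW|lra|move=> t /andP[t0 th_]].
  have [->|t0'] := eqVneq t 0; first by right; left.
  by left; rewrite lt_eqF// lo// th_ andbT lt_neqAle eq_sym t0' t0.
have E3 : th 1 - th (1 - h) = carg (- r 1) - carg (- r (1 - h)).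
  apply: flip; [lra|lra|by []|move=> t /andP[t0 th_]].
  have [->|t0'] := eqVneq t 1; first by right; right.
  by left; rewrite gt_eqF// hi// t0 lt_neqAle t0' th_.
have E2 : th (1 - h) - th h = carg (r (1 - h)) - carg (r h).
  have sl' (t : R) : h <= t <= 1 - h -> 0 < cmod (r t) + (r t).1.
    by move=> /andP[ht th_]; apply: sl; apply/andP; split; lra.
  apply: (key (fun t => carg (r t))); [lra|lra|lra|move=> t /sl' st|move=> t /sl' st].
    exact: (@cont_carg R R r t (cr t)).
  exact: polar_carg.
have F1 := @carg_opp (r h) ltac:(by apply: lo; rewrite h0 lexx).
have F2 := @carg_opp (- r (1 - h)) ltac:(by rewrite /= oppr_lt0; apply: hi; lra).
rewrite opprK in F2; rewrite r10 in E3.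
lra.
Qed.

Lemma isd_add (f g : R -> R) (t l m : R) : is_derive t 1 f l -> is_derive t 1 g m ->
  is_derive t 1 (fun u => f u + g u) (l + m).
Proof. by move=> fd gd; exact: (is_deriveD fd gd). Qed.

Lemma isd_eq (f : R -> R) (t l m : R) : is_derive t 1 f l -> l = m -> is_derive t 1 f m.
Proof. by move=> + <-. Qed.

Lemma isd_mul (f g : R -> R) (t l m : R) : is_derive t 1 f l -> is_derive t 1 g m ->
  is_derive t 1 (fun u => f u * g u) (l * g t + f t * m).
Proof.
move=> fd gd; apply: (isd_eq (is_deriveM fd gd)).
by rewrite /GRing.scale /=; ring.
Qed.

Lemma isd_scale (f : R -> R) (c t l : R) : is_derive t 1 f l ->
  is_derive t 1 (fun u => c * f u) (c * l).
Proof. by move=> fd; exact: (is_deriveZ c fd). Qed.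

Lemma isd_addc (f : R -> R) (c t l : R) : is_derive t 1 f l ->
  is_derive t 1 (fun u => f u + c) l.
Proof. by move=> fd; have := is_deriveD fd (is_derive_cst c t 1); rewrite addr0. Qed.

Lemma isd_sqr (f : R -> R) (t l : R) : is_derive t 1 f l ->
  is_derive t 1 (fun u => f u ^+ 2) (2 * f t * l).
Proof.
move=> fd; have -> : (fun u => f u ^+ 2) = (fun u => f u * f u).
  by apply/funext => u; rewrite expr2.
by apply: (isd_eq (isd_mul fd fd)); ring.
Qed.

Lemma MVT_any (f df : R -> R) (a b : R) :
  (forall z : R, `|z - a| <= `|b - a| -> is_derive z 1 f (df z)) ->
  exists2 c : R, `|c - a| <= `|b - a| & f b - f a = df c * (b - a).
Proof.
move=> fd.
have cont (u v : R) : u <= v -> (forall z : R, u <= z <= v -> is_derive z 1 f (df z)) ->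
    exists2 c : R, u <= c <= v & f v - f u = df c * (v - u).
  move=> uv H; have [||c] := @MVT_segment _ f df u v uv.
  - by move=> z; rewrite in_itv /= => /andP[uz zv]; apply: H; rewrite !ltW.
  - apply: derivable_within_continuous => z; rewrite in_itv /= => /H zd.
    exact: ex_derive.
  - by rewrite in_itv /= => ? ?; exists c.
have [ab|ba] := leP a b.
  have [|c /andP[ac cb] E] := cont a b ab.
    by move=> z /andP[az zb]; apply: fd; rewrite !ger0_norm; lra.
  by exists c => //; rewrite !ger0_norm; lra.
have [|c /andP[ac cb] E] := cont b a (ltW ba).
  by move=> z /andP[az zb]; apply: fd; rewrite !ler0_norm; lra.
by exists c; [rewrite !ler0_norm; lra|lra].
Qed.

End Cross.

(** * Simple closed curves bounding a domain *)

Section Curve.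
(** The curve is taken with period 1 and constant speed [L], to match loops on the unit interval;
    (a, b) is its unit tangent. *)
Variables (R : realType) (x y a b : R -> R) (L : R).
Hypotheses (L0 : 0 < L)
  (dx : forall t : R, is_derive t 1 x (L * a t))
  (dy : forall t : R, is_derive t 1 y (L * b t))
  (ca : continuous a) (cb : continuous b)
  (ab1 : forall t, a t ^+ 2 + b t ^+ 2 = 1)
  (px : forall t, x (t + 1) = x t) (py : forall t, y (t + 1) = y t)
  (pa : forall t, a (t + 1) = a t) (pb : forall t, b (t + 1) = b t)
  (simple : forall t u : R, 0 <= t < 1 -> 0 <= u < 1 -> x t = x u -> y t = y u -> t = u).

Definition pt t : R * R := (x t, y t).
(** The offset is along the left unit normal (- b t, a t). *)
Definition tub t s : R * R := (x t - s * b t, y t + s * a t).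

Lemma per_int (f : R -> R) : (forall t, f (t + 1) = f t) ->
  forall t (n : int), f (t + n%:~R) = f t.
Proof.
move=> pf; have pn t (n : nat) : f (t + n%:R) = f t.
  by elim: n => [|n IH]; [rewrite addr0|rewrite -natr1 addrA pf].
move=> t [n|n]; first exact: pn.
by rewrite NegzE -[in RHS](subrK n.+1%:R t) pn mulrNz.
Qed.

Lemma frac (t : R) : exists n : int, 0 <= t + n%:~R < 1.
Proof.
exists (- Num.floor t); have := floor_itv t; rewrite intrD => /andP[? ?].
by rewrite mulrNz; apply/andP; split; lra.
Qed.

Lemma pt_int t (n : int) : pt (t + n%:~R) = pt t.
Proof. by rewrite /pt !per_int. Qed.

Lemma pt_inj t u : pt t = pt u -> exists n : int, u = t + n%:~R.
Proof.
have [n ht] := frac t; have [m hu] := frac u.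
rewrite -(pt_int t n) -(pt_int u m) => -[ex ey].
by exists (n - m); rewrite intrB addrA (simple ht hu ex ey) addrK.
Qed.

Lemma cx : continuous x.
Proof. by move=> t; apply: differentiable_continuous; apply/derivable1_diffP; apply: ex_derive. Qed.

Lemma cy : continuous y.
Proof. by move=> t; apply: differentiable_continuous; apply/derivable1_diffP; apply: ex_derive. Qed.

Lemma cpt : continuous pt.
Proof. by move=> t; apply: cont_pair; [exact: cx|exact: cy]. Qed.

Lemma ctub (f g : R -> R) t : {for t, continuous f} -> {for t, continuous g} ->
  {for t, continuous (fun z => tub (f z) (g z))}.
Proof.
move=> cf cg; apply: cont_pair.
  apply: cvgB; first by apply: continuous_comp => //; exact: cx.
  by apply: cvgM => //; apply: continuous_comp => //; exact: cb.
apply: cvgD; first by apply: continuous_comp => //; exact: cy.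
by apply: cvgM => //; apply: continuous_comp => //; exact: ca.
Qed.

(** Near [t0] the curve is strictly monotone in the direction of its tangent at [t], and [tub t s]
    projects to the same value as [pt t] in this direction. So u = t, and then s = 0. *)
Lemma tub_local t0 : exists2 e : R, 0 < e & forall t u s,
  `|t0 - t| < e -> `|t0 - u| < e -> tub t s = pt u -> s = 0.
Proof.
have [||t _|e e0 eP] := @unif_dot R R [set t0] (fun t => (a t, b t)).
- exact: compact_set1.
- by move=> t _; apply: cont_pair; [exact: ca|exact: cb].
- rewrite -dot_gt0 /dot /= -!expr2 ab1; exact: ltr01.
exists (e / 3); first by rewrite divr_gt0.
move=> t u s tt tu [E1 E2].
have dw (z : R) : is_derive z 1 (fun w => a t * x w + b t * y w) (a t * (L * a z) + b t * (L * b z)).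
  exact: (isd_add (isd_scale (a t) (dx z)) (isd_scale (b t) (dy z))).
have [w wt] := @MVT_any R _ _ t u (fun z _ => dw z).
rewrite -E1 -E2 => E.
have tw : `|t0 - w| < e.
  have ut : `|u - t| < 2 * (e / 3).
    have -> : u - t = (t0 - t) - (t0 - u) by rewrite opprB [RHS]addrC addrA subrK.
    by rewrite (le_lt_trans (ler_normB _ _))//; lra.
  have -> : t0 - w = (t0 - t) - (w - t) by rewrite opprB addrA subrK.
  by rewrite (le_lt_trans (ler_normB _ _))//; lra.
have {}tt : `|t0 - t| < e by lra.
have d0 := eP t0 erefl t w tt tw; rewrite /dot /= in d0.
have : L * (a t * a w + b t * b w) * (u - t) = 0.
  transitivity (a t * (x t - s * b t) + b t * (y t + s * a t) - (a t * x t + b t * y t)).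
    by rewrite E; ring.
  by ring.
move=> /eqP; rewrite mulf_eq0 gt_eqF ?mulr_gt0//= subr_eq0 => /eqP ut.
move: E1 E2; rewrite ut => E1 E2; have := ab1 t.
have [//|s0] := eqVneq s 0.
have a0 : a t = 0 by apply: (mulfI s0); lra.
have b0 : b t = 0 by apply: (mulfI s0); lra.
by rewrite a0 b0 => /eqP; rewrite expr0n addr0 eq_sym oner_eq0.
Qed.

(** Compactness in the pair of parameters. Near two parameters of the same point the local statement
    applies after an integer shift; near those of two distinct points it is enough that |s| is less
    than half their distance. *)
Lemma tub_avoid : exists2 s0 : R, 0 < s0 & forall t u s : R,
  s != 0 -> `|s| <= s0 -> tub t s <> pt u.
Proof.
have [||e e0 eP] := @compact_right R (R * R)%type (@square R)
    (fun e z => forall s : R, s != 0 -> `|s| < e -> tub z.1 s <> pt z.2).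
- exact: compact_square.
- move=> [t0 u0] _; have [E|ne] := eqVneq (pt t0) (pt u0).
    have [n un] := pt_inj E; have [e e0 eP] := tub_local t0.
    exists e => // -[t u] e' + _ s s0 _ /= Ets.
    rewrite norm_pair_lt /= => /andP[tt uu].
    move/eqP: s0; apply; apply: (eP t (u - n%:~R) s tt).
      by rewrite -opprB normrN; move: uu; rewrite un -opprB normrN; congr (`|_| < _); ring.
    by rewrite Ets -[in LHS](subrK n%:~R u) pt_int.
  have d0 : 0 < `|pt t0 - pt u0| by rewrite normr_gt0 subr_eq0.
  set d := `|pt t0 - pt u0| in d0.
  have cF : {for (t0, u0), continuous (fun z : R * R => pt z.1 - pt z.2)}.
    apply: cvgB; apply: continuous_comp.
    - exact: cvg_fst.
    - exact: cpt.
    - exact: cvg_snd.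
    - exact: cpt.
  have d2 : 0 < d / 2 by rewrite divr_gt0.
  have /cvgrPdist_lt /(_ _ d2) /nbhs_ballP[r /= r0 rP] := cF.
  exists (Num.min r (d / 2)); first by rewrite lt_min r0.
  move=> [t u] e; rewrite !lt_min => /andP[hr _] /andP[e0 /andP[_ ed]] s s0 se /= Ets.
  have := rP (t, u); rewrite -ball_normE /= => /(_ hr).
  rewrite ltNge => /negP; apply.
  have : `|pt t - pt u| <= `|s|.
    rewrite -Ets norm_pair_le /pt /tub /=.
    have := ab1 t => ab.
    have b1 : `|b t| <= 1 by rewrite ler_norml; apply/andP; split; nra.
    have a1 : `|a t| <= 1 by rewrite ler_norml; apply/andP; split; nra.
    have -> : x t - (x t - s * b t) = s * b t by rewrite opprB addrC subrK.
    have -> : y t - (y t + s * a t) = - (s * a t) by rewrite opprD addrA subrr add0r.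
    by rewrite normrN !normrM !ler_piMr.
  have : d <= `|pt t0 - pt u0 - (pt t - pt u)| + `|pt t - pt u|.
    by have := ler_normD (pt t0 - pt u0 - (pt t - pt u)) (pt t - pt u); rewrite subrK.
  by lra.
exists (e / 2); first by rewrite divr_gt0.
move=> t u s s0 se E.
have [n hn] := frac t; have [m hm] := frac u.
have := eP (t + n%:~R, u + m%:~R); rewrite /square /unit_itv /=.
move=> /(_ ltac:(split; [case/andP: hn|case/andP: hm] => ? ?; apply/andP; split => //; exact: ltW)).
move=> /(_ s s0 ltac:(lra)); apply; rewrite pt_int -E /tub !per_int//.
Qed.

Variable D : set (R * R).
Local Notation inD := (interior D).
(** Parameter 0 is a lowest point of the curve, where the tangent is (1, 0) and the interior lies
    above. *)
Hypotheses (clD : closed D) (ptD : forall t, ~ inD (pt t))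
  (bdD : forall p, D p -> ~ inD p -> exists t, p = pt t)
  (a0 : a 0 = 1) (b0 : b 0 = 0)
  (ylow : forall t, y 0 <= y t) (Dlow : forall p, inD p -> y 0 < p.2)
  (left_in : forall t, exists2 e : R, 0 < e & forall s : R, 0 < s < e -> inD (tub t s)).

Definition wnd (q : R * R) := turn (fun t => pt t - q).

Lemma pt01 : pt 1 = pt 0.
Proof. by rewrite -[in LHS](add0r 1) /pt px py. Qed.

Lemma wnd_path (q : R -> R * R) : continuous q ->
  (forall s, unit_itv s -> forall u, q s <> pt u) -> wnd (q 0) = wnd (q 1).
Proof.
move=> cq qpt; apply: (@turn_homotopy R (fun z => pt z.2 - q z.1)).
- move=> z; apply: cvgB; apply: continuous_comp.
  + exact: cvg_snd.
  + exact: cpt.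
  + exact: cvg_fst.
  + exact: cq.
- by move=> [s t] [/= s01 _]; rewrite subr_eq0 eq_sym; apply/eqP; exact: qpt.
- by move=> s _ /=; rewrite pt01.
Qed.

(** Off the curve [D] and its interior coincide, so the interior is open and closed relative to the
    path, whose image is connected. *)
Lemma inD_path (q : R -> R * R) : continuous q ->
  (forall s, unit_itv s -> forall u, q s <> pt u) -> inD (q 0) -> inD (q 1).
Proof.
move=> cq qpt q0.
have /connected_continuous_connected conn : connected (@unit_itv R).
  rewrite unit_itvE; apply/connected_intervalP; exact: interval_is_interval.
have := conn _ q (continuous_subspaceT cq); set A := [set q s | s in _] => cA.
have : A `&` inD = A.
  apply: cA.
  - by exists (q 0); split=> //; exists 0 => //; exact: unit0.
  - by exists inD => //; exact: open_interior.
  - exists D => //; apply/seteqP; split => p [Ap Dp]; split=> //.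
      exact: interior_subset.
    by apply: contrapT => nDp; have [t pE] := bdD Dp nDp;
      case: Ap => s s01 qs; apply: (qpt s s01 t); rewrite qs.
move=> E; have : A (q 1) by exists 1 => //; exact: unit1.
by rewrite -E => -[].
Qed.

Definition same (p q : R * R) := (inD p <-> inD q) /\ wnd p = wnd q.

Lemma same_path (q : R -> R * R) : continuous q ->
  (forall s, unit_itv s -> forall u, q s <> pt u) -> same (q 0) (q 1).
Proof.
move=> cq qpt; split; last exact: wnd_path.
split; first exact: inD_path.
have := @inD_path (fun s => q (1 - s)); rewrite subrr subr0; apply.
  move=> s; apply: continuous_comp; last exact: cq.
  by apply: cvgB; [exact: cvg_cst|exact: cvg_id].
move=> s s01; apply: qpt; move: s01; rewrite /unit_itv /= => /andP[? ?].
by apply/andP; split; lra.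
Qed.

Lemma same_trans p q r : same p q -> same q r -> same p r.
Proof. by move=> [h1 e1] [h2 e2]; split; [rewrite h1|rewrite e1]. Qed.

(** From below the lowest point the whole curve is seen in the open upper half-plane. *)
Lemma wnd_low (s : R) : 0 < s -> wnd (tub 0 (- s)) = 0.
Proof.
move=> s0; apply: turn_slit.
- by move=> t; apply: cvgB; [exact: cpt|exact: cvg_cst].
- by rewrite pt01.
move=> t _; rewrite cmod_slit /= a0; apply/orP; left.
by have := ylow t => h; rewrite gt_eqF//; lra.
Qed.

Lemma x_near0 : exists2 h : R, 0 < h < 1 / 2 & forall t : R, `|t| <= h -> 0 < t -> x 0 < x t /\ x (- t) < x 0.
Proof.
have := @cvgr_gt _ _ _ _ a (a 0) (@ca 0) 0; rewrite a0 => /(_ _ ltr01) /nbhs_ballP[r /= r0 rP].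
have key (t : R) : `|t| < r -> exists2 c : R, 0 < a c & x t - x 0 = L * a c * t.
  move=> tr; have [c ct E] := @MVT_any R x (fun t => L * a t) 0 t (fun z _ => dx z).
  exists c; last by rewrite E subr0.
  by apply: rP; rewrite -ball_normE /= sub0r normrN; move: ct; rewrite !subr0 => ct; exact: le_lt_trans tr.
exists (Num.min (r / 2) (1 / 4)).
  have : Num.min (r / 2) (1 / 4) <= 1 / 4 by rewrite ge_min lexx orbT.
  move=> h; apply/andP; split; last by lra.
  by rewrite lt_min; apply/andP; split; lra.
move=> t; rewrite le_min => /andP[tr _] t0.
have [c c0 E] := key t ltac:(lra); have [c' c'0 E'] := key (- t) ltac:(rewrite normrN; lra).
have : 0 < L * a c * t by rewrite !mulr_gt0.
have : 0 < L * a c' * t by rewrite !mulr_gt0.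
by split; lra.
Qed.

(* Seen from [tub 0 (- s)], below the lowest point, the curve does not turn. The
   quotient of the vectors to [pt t] from [tub 0 s] and from [tub 0 (- s)] meets
   the negative real axis at [t = 0] only. *)
Lemma wnd_high (s0 s : R) : (forall t u s : R, s != 0 -> `|s| <= s0 -> tub t s <> pt u) ->
  0 < s <= s0 -> wnd (tub 0 s) = 2 * pi.
Proof.
move=> av /andP[sp ss0].
have pp (e : R) : e != 0 -> `|e| <= s0 -> nzpath (fun t => pt t - tub 0 e).
  move=> e0 es; split=> [t|t _]; first by apply: cvgB; [exact: cpt|exact: cvg_cst].
  by rewrite subr_eq0 eq_sym; apply/eqP; exact: av.
have p1 := pp s ltac:(by rewrite gt_eqF) ltac:(by rewrite gtr0_norm).
have p2 := pp (- s) ltac:(by rewrite oppr_eq0 gt_eqF) ltac:(by rewrite normrN gtr0_norm).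
have E : turn (fun t => cmul (pt t - tub 0 s) (conjp (pt t - tub 0 (- s)))) = wnd (tub 0 s).
  have := wnd_low sp; rewrite /wnd => w0.
  by rewrite (turn_mul p1 (nzpath_conj p2)) turn_conj// w0 oppr0 addr0.
rewrite -E; have [cr _] := nzpath_mul p1 (nzpath_conj p2).
have [h h01 hx] := x_near0.
have e1 t : (cmul (pt t - tub 0 s) (conjp (pt t - tub 0 (- s)))).1 =
    (x t - x 0) ^+ 2 + (y t - y 0) ^+ 2 - s ^+ 2.
  by rewrite /cmul /= a0 b0; ring.
have e2 t : (cmul (pt t - tub 0 s) (conjp (pt t - tub 0 (- s)))).2 = 2 * s * (x 0 - x t).
  by rewrite /cmul /= a0 b0; ring.
have s2 : 0 < 2 * s by lra.
apply: (@turn_cross _ _ h) => //.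
- by rewrite pt01.
- by rewrite e1 !subrr expr0n !add0r oppr_lt0 exprn_gt0.
- by rewrite e2 subrr mulr0.
- move=> t /andP[t0 t1]; rewrite cmod_slit e1 e2 mulf_eq0 (gt_eqF s2) /= subr_eq0.
  have [xt|//] := eqVneq (x 0) (x t); rewrite xt subrr expr0n add0r /=.
  (* A point of the curve vertically above the lowest one, at height [B], equals [tub 0 B]. So
     [B <= s] is excluded by the choice of [s0] when [B] is nonzero, and by simplicity of the curve
     when it is 0. *)
  have yt := ylow t; set B := y t - y 0.
  have tubB : tub 0 B = pt t by rewrite /tub /pt a0 b0 /B xt; congr pair; ring.
  suff : s < B by move=> sB; have : s ^+ 2 < B ^+ 2 by [rewrite ltr_pXn2r// nnegrE; lra]; lra.
  rewrite ltNge; apply/negP => Bs.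
  have B0 : 0 <= B by rewrite subr_ge0.
  have [B00|Bn0] := eqVneq B 0; last first.
    by apply: (av 0 t B Bn0 _ tubB); rewrite ger0_norm//; lra.
  have := @simple 0 t; rewrite lexx ltr01 (ltW t0) t1 => /(_ isT isT xt ltac:(rewrite /B in B00; lra)).
  by lra.
- move=> t /andP[t0 th]; rewrite e2 pmulr_rlt0//.
  by have [? ?] := hx t ltac:(by rewrite gtr0_norm) t0; lra.
move=> t /andP[t0 t1]; rewrite e2 pmulr_rgt0//.
have [||_] := hx (1 - t); rewrite ?subr_gt0//; first by rewrite gtr0_norm ?subr_gt0//; lra.
by have := px (t - 1); rewrite subrK opprB; lra.
Qed.

Lemma convex_le (s p q w : R) : 0 <= s <= 1 -> q < w -> w <= (1 - s) * p + s * q -> w <= p.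
Proof.
move=> /andP[s0 s1] qw wpq; rewrite leNgt; apply/negP => pw.
have h1 : 0 <= (1 - s) * (w - p) by rewrite mulr_ge0// subr_ge0// ltW.
have [sE|sn] := eqVneq s 0; first by rewrite sE in wpq; lra.
have h2 : 0 < s * (w - q) by rewrite mulr_gt0 ?subr_gt0// lt_neqAle eq_sym sn.
lra.
Qed.

(* The segment from [q] to a nearest point of the curve is normal to it, and
   inside the tube one can slide along the curve to its lowest point. *)
Lemma wnd_classify q : (forall t, q <> pt t) ->
  (inD q /\ wnd q = 2 * pi) \/ (~ inD q /\ wnd q = 0).
Proof.
move=> qpt; have [s0 s00 av] := tub_avoid.
pose f t := (x t - q.1) ^+ 2 + (y t - q.2) ^+ 2.
have df (t : R) : is_derive t 1 f (2 * L * ((x t - q.1) * a t + (y t - q.2) * b t)).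
  have h1 := isd_addc (- q.1) (dx t); have h2 := isd_addc (- q.2) (dy t).
  by apply: (isd_eq (isd_add (isd_sqr h1) (isd_sqr h2))); ring.
have fp t : f (t + 1) = f t by rewrite /f px py.
have cf : continuous f.
  by move=> t; apply: differentiable_continuous; apply/derivable1_diffP; apply: ex_derive.
have [t1 _ fmin] := @compact_EVT_min _ _ f _ (ex_intro _ 0 (@unit0 R)) (@compact_unit R)
  (continuous_subspaceT cf).
have {}fmin t : f t1 <= f t.
  have [n /andP[n0 n1]] := frac t; rewrite -(per_int fp t n); apply: fmin.
  by rewrite inE /unit_itv /= n0 ltW.
have f'0 : 2 * L * ((x t1 - q.1) * a t1 + (y t1 - q.2) * b t1) = 0.
  have t1i : t1 \in `]t1 - 1, t1 + 1[ by rewrite in_itv /=; apply/andP; split; lra.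
  have := @derive1_at_min _ f (t1 - 1) (t1 + 1) t1 ltac:(lra) (fun t _ => ex_derive (is_derive := df t)) t1i (fun t _ => fmin t).
  by move=> /@derive_val <-; rewrite derive_val.
have fn0 : 0 < f t1.
  rewrite lt_neqAle addr_ge0 ?sqr_ge0// andbT eq_sym.
  rewrite paddr_eq0 ?sqr_ge0// !sqrf_eq0 !subr_eq0; apply/negP => /andP[/eqP e1 /eqP e2].
  by apply: (qpt t1); rewrite /pt e1 e2 -surjective_pairing.
(* The signed offset of [q] along the normal at the nearest point; the tangential offset is 0
   because the derivative of the squared distance vanishes there. *)
pose sg := - (q.1 - x t1) * b t1 + (q.2 - y t1) * a t1.
have perp : (x t1 - q.1) * a t1 + (y t1 - q.2) * b t1 = 0.
  by move/eqP: f'0; rewrite mulf_eq0 gt_eqF ?mulr_gt0//= => /eqP.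
have qE : q = tub t1 sg.
  rewrite [LHS]surjective_pairing /tub; have ab := ab1 t1; congr pair.
    have -> : x t1 - sg * b t1 = x t1 + (q.1 - x t1) * (a t1 ^+ 2 + b t1 ^+ 2)
       + a t1 * ((x t1 - q.1) * a t1 + (y t1 - q.2) * b t1) by rewrite /sg; ring.
    by rewrite ab perp; ring.
  have -> : y t1 + sg * a t1 = y t1 + (q.2 - y t1) * (a t1 ^+ 2 + b t1 ^+ 2)
       + b t1 * ((x t1 - q.1) * a t1 + (y t1 - q.2) * b t1) by rewrite /sg; ring.
  by rewrite ab perp; ring.
have fsg : f t1 = sg ^+ 2.
  by rewrite /f qE /=; have -> : sg ^+ 2 = sg ^+ 2 * (a t1 ^+ 2 + b t1 ^+ 2); [rewrite ab1 mulr1|ring].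
have sgn0 : sg != 0 by rewrite -sqrf_eq0 -fsg gt_eqF.
(* Such a [pt t] would be nearer to [q] than the minimum of [f] allows. *)
have near_av t s : 0 < s * sg -> `|s| <= `|sg| -> tub t1 s <> pt t.
  move=> ssg sle [e1 e2]; have := fmin t; rewrite fsg /f -e1 -e2 qE /= leNgt => /negP; apply.
  have -> : (x t1 - s * b t1 - (x t1 - sg * b t1)) ^+ 2 + (y t1 + s * a t1 - (y t1 + sg * a t1)) ^+ 2
     = (s - sg) ^+ 2 * (a t1 ^+ 2 + b t1 ^+ 2) by ring.
  rewrite ab1 mulr1.
  have : s ^+ 2 <= s * sg.
    by rewrite -[s * sg]gtr0_norm// normrM -real_normK ?num_real// expr2 ler_wpM2l.
  nra.
have lin (p r : R) : continuous (fun s : R => p + s * (r - p)).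
  by move=> s; apply: cvgD; [exact: cvg_cst|apply: cvgMl; exact: cvg_id].
(* Along the normal from [q] into the tube, then inside the tube to parameter 0. On the normal an
   offset is either at most [s0] or, by convexity, at most |sg|. *)
have go (s1 : R) : s1 != 0 -> `|s1| <= s0 -> 0 < s1 * sg -> same q (tub 0 s1).
  move=> s1n s1s s1sg.
  apply: (same_trans (q := tub t1 s1)).
    have := @same_path (fun s => tub t1 (sg + s * (s1 - sg))).
    rewrite !mul0r addr0 mul1r (addrC sg) subrK -qE; apply.
      by move=> s; apply: (ctub (f := fun _ => t1) (t := s)); [exact: cvg_cst|exact: lin].
    move=> s /andP[z0 z1] u.
    have sign : 0 < (sg + s * (s1 - sg)) * sg.
      have : 0 < sg ^+ 2 by rewrite exprn_even_gt0.
      have -> : (sg + s * (s1 - sg)) * sg = (1 - s) * sg ^+ 2 + s * (s1 * sg) by ring.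
      have [->|sn] := eqVneq s 0; first by move=> ?; lra.
      have sp : 0 < s by rewrite lt_neqAle eq_sym sn.
      move=> s2; apply: ltr_wpDl; last by rewrite mulr_gt0.
      by rewrite mulr_ge0 ?subr_ge0// ltW.
    have [le|gt] := leP `|sg + s * (s1 - sg)| s0.
      by apply: av => //; apply: contraTneq sign => ->; rewrite mul0r ltxx.
    apply: near_av => //.
    have : `|sg + s * (s1 - sg)| <= (1 - s) * `|sg| + s * `|s1|.
      rewrite (_ : sg + _ = (1 - s) * sg + s * s1); last by ring.
      rewrite (le_trans (ler_normD _ _))// !normrM (ger0_norm z0) ger0_norm ?subr_ge0//.
    by apply: convex_le; rewrite ?z0// (le_lt_trans s1s).
  have := @same_path (fun s => tub (t1 + s * (0 - t1)) s1).
  rewrite !mul0r addr0 mul1r (addrC t1) subrK; apply.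
    by move=> s; apply: (ctub (g := fun _ => s1) (t := s)); [exact: lin|exact: cvg_cst].
  by move=> s _ u; apply: av.
have [sgp|sgm] := ltP 0 sg.
  left; have [hin hw] := go s0 ltac:(by rewrite gt_eqF) ltac:(by rewrite gtr0_norm) ltac:(by rewrite mulr_gt0).
  have [e e0 el] := left_in 0.
  pose m := Num.min (e / 2) s0.
  have m0 : 0 < m by rewrite lt_min s00 divr_gt0.
  have ms : m <= s0 by rewrite ge_min lexx orbT.
  have me : m < e by have : m <= e / 2 by [rewrite ge_min lexx]; lra.
  have [hm _] := go m ltac:(by rewrite gt_eqF) ltac:(by rewrite gtr0_norm) ltac:(by rewrite mulr_gt0).
  split; first by apply/hm; apply: el; rewrite m0.
  by rewrite hw; apply: (wnd_high av); rewrite s00 lexx.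
right.
have sgm' : sg < 0 by rewrite lt_neqAle sgn0.
have [hin hw] := go (- s0) ltac:(by rewrite oppr_eq0 gt_eqF) ltac:(by rewrite normrN gtr0_norm)
  ltac:(by rewrite nmulr_lgt0// oppr_lt0).
split; last by rewrite hw wnd_low.
by move/hin/Dlow; rewrite /tub a0 /=; lra.
Qed.

(* On the torus of vectors [pt u - tub t s0] the diagonal is the sum of the two
   circles; it is normal to the curve, and the two circles turn by [2 * pi]
   ([tub 1 s0] is inside the curve) and by [0] ([pt 0] is the lowest point). *)
Lemma turn_tangent : turn (fun t => (a t, b t)) = 2 * pi.
Proof.
have [s0 s00 av] := tub_avoid.
have inT t : inD (tub t s0).
  have [e e0 el] := left_in t.
  pose m := Num.min (e / 2) s0.
  have m0 : 0 < m by rewrite lt_min s00 divr_gt0.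
  have ms : m <= s0 by rewrite ge_min lexx orbT.
  have me : m < e by have : m <= e / 2 by [rewrite ge_min lexx]; lra.
  have := @inD_path (fun s => tub t (m + s * (s0 - m))).
  rewrite mul0r addr0 mul1r (addrC m) subrK; apply; last by apply: el; rewrite m0.
    move=> s; apply: (ctub (f := fun _ => t) (g := fun s => m + s * (s0 - m)) (t := s)).
      exact: cvg_cst.
    by apply: cvgD; [exact: cvg_cst|apply: cvgMl; exact: cvg_id].
  move=> s /andP[z0 z1] u; have : 0 < m + s * (s0 - m) by nra.
  have : m + s * (s0 - m) <= s0 by nra.
  by move=> h1 h2; apply: av; [rewrite gt_eqF|rewrite gtr0_norm].
pose F (z : R * R) := pt z.2 - tub z.1 s0.
have cF : continuous F.
  move=> z; apply: cvgB; first by apply: continuous_comp; [exact: cvg_snd|exact: cpt].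
  apply: (@continuous_comp _ _ _ fst (fun t => tub t s0)); first exact: cvg_fst.
  by apply: (ctub (f := id) (g := fun _ => s0)); [exact: cvg_id|exact: cvg_cst].
have s0n : s0 != 0 by rewrite gt_eqF.
have s0l : `|s0| <= s0 by rewrite gtr0_norm.
have F0 z : F z != 0 by rewrite subr_eq0 eq_sym; apply/eqP; exact: av.
have := turn_diag cF (fun z _ => F0 z).
have tubp t : tub (t + 1) s0 = tub t s0 by rewrite /tub px py pa pb.
have -> : turn (fun t => F (t, 0)) = 0.
  apply: turn_slit.
  - by move=> t; apply: (@continuous_comp _ _ _ (fun t => (t, 0))); [apply: cont_pair; [exact: cvg_id|exact: cvg_cst]|exact: cF].
  - by rewrite /F /= -{1}(add0r 1) tubp.
  - by move=> t _; rewrite cmod_slit /=; have /Dlow h := inT t; rewrite lt_eqF// subr_lt0.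
have -> : turn (fun t => F (1, t)) = 2 * pi.
  have T1 : tub 1 s0 = tub 0 s0 by rewrite -{1}(add0r 1) tubp.
  by have := wnd_high av (s := s0); rewrite /wnd s00 lexx /F /= T1 => /(_ isT).
rewrite add0r => <-.
have pT : nzpath (fun t => (a t, b t)).
  split=> [t|t _]; first by apply: cont_pair; [exact: ca|exact: cb].
  by rewrite -dot_gt0 /dot /= -!expr2 ab1 ltr01.
have pc : nzpath (fun _ : R => (0, - s0)).
  by split=> [t|t _]; [exact: cvg_cst|rewrite pair_eq0 /= oppr_eq0 (negbTE s0n) andbF].
(* The diagonal vector is - s0 times the normal, that is, the tangent times the constant - i s0. *)
have -> : (fun t => F (t, t)) = (fun t => cmul (0, - s0) (a t, b t)).
  by apply/funext => t; rewrite /F /cmul /pt /tub; congr pair => /=; ring.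
rewrite (turn_mul pc pT) [X in _ = X + _]turn_slit ?add0r//.
  by move=> t; exact: cvg_cst.
by move=> t _; rewrite cmod_slit /= oppr_eq0 s0n.
Qed.

End Curve.

(** * The vector field along the boundary *)

Section Calculus.
Variable R : realType.

Lemma caratheodory_isd (F A : R -> R) (t : R) :
  (forall u, F u - F t = A u * (u - t)) -> {for t, continuous A} -> is_derive t 1 F (A t).
Proof.
move=> FA cA.
have H : h^-1 *: ((F \o shift t) (h *: 1) - F t) @[h --> 0^'] --> A t.
  have : A (h + t) @[h --> (0:R)^'] --> A t.
    have : {for 0, continuous (fun h : R => A (h + t))}.
      apply: continuous_comp; first by apply: cvgD; [exact: cvg_id|exact: cvg_cst].
      by rewrite add0r.
    by rewrite /prop_for /continuous_at add0r; apply: cvg_trans; apply: cvg_app; exact: nbhs_dnbhs.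
  apply: cvg_trans; apply: near_eq_cvg; near=> h.
  have h0 : h != 0 by near: h; exact: nbhs_dnbhs_neq.
  by rewrite /= FA addrK /GRing.scale /= mulr1 mulrCA mulVf// mulr1.
by apply: DeriveDef; [exact: cvgP H|exact: cvg_lim H].
Unshelve. all: by end_near. Qed.

Lemma isd_caratheodory (F : R -> R) (t l : R) : is_derive t 1 F l ->
  exists2 A : R -> R, A t = l /\ {for t, continuous A} & forall u, F u - F t = A u * (u - t).
Proof.
move=> Fd; pose A u := if u == t then l else (F u - F t) / (u - t).
have At : A t = l by rewrite /A eqxx.
exists A; last first.
  move=> u; rewrite /A; have [->|ut] := eqVneq u t; first by rewrite !subrr mulr0.
  by rewrite divfK// subr_eq0.
split=> //; apply/cvgrPdist_lt => e e0.
have H : h^-1 *: ((F \o shift t) (h *: 1) - F t) @[h --> 0^'] --> l.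
  by have := @ex_derive _ _ _ _ _ _ _ Fd; rewrite -(derive_val (is_derive := Fd)).
move/cvgrPdist_lt : H => /(_ e e0) /nbhs_ballP[r /= r0 rP].
apply/nbhs_ballP; exists r => //= u tu.
have {}tu : `|t - u| < r by move: tu; rewrite -?ball_normE.
rewrite At /A; have [_|ut] := eqVneq u t; first by rewrite subrr normr0.
have := rP (u - t); rewrite -ball_normE /= sub0r normrN distrC => /(_ tu).
rewrite subr_eq0 => /(_ ut); rewrite /GRing.scale /= mulr1 subrK mulrC.
by [].
Qed.

(** The increment of [f] is split at (g t, h u). By the mean value theorem both difference
    quotients, completed by the partial derivatives, are continuous at [t]; together they form a
    slope function in the sense of Caratheodory. *)
Lemma chain2 (f fx fy : R * R -> R) (g h : R -> R) (t r g' h' : R) : 0 < r ->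
  (forall q : R * R, `|(g t, h t) - q| < r -> is_derive q.1 1 (fun u => f (u, q.2)) (fx q)) ->
  (forall q : R * R, `|(g t, h t) - q| < r -> is_derive q.2 1 (fun v => f (q.1, v)) (fy q)) ->
  {for (g t, h t), continuous fx} -> {for (g t, h t), continuous fy} ->
  is_derive t 1 g g' -> is_derive t 1 h h' ->
  is_derive t 1 (fun u => f (g u, h u)) (fx (g t, h t) * g' + fy (g t, h t) * h').
Proof.
move=> r0 dfx dfy cfx cfy gd hd.
have [Ag [Agt cAg] EAg] := isd_caratheodory gd.
have [Ah [Aht cAh] EAh] := isd_caratheodory hd.
have cg : {for t, continuous g} by apply: differentiable_continuous; apply/derivable1_diffP; exact: ex_derive.
have ch : {for t, continuous h} by apply: differentiable_continuous; apply/derivable1_diffP; exact: ex_derive.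
pose p := (g t, h t).
pose A1 u := if g u == g t then fx p else (f (g u, h u) - f (g t, h u)) / (g u - g t).
pose A2 u := if h u == h t then fy p else (f (g t, h u) - f (g t, h t)) / (h u - h t).
have cgh : {for t, continuous (fun u => (g u, h u))} by exact: cont_pair.
have cA1 : {for t, continuous A1}.
  apply/cvgrPdist_lt => e e0.
  move/cvgrPdist_lt : cfx => /(_ e e0) /nbhs_ballP[d /= d0 dP].
  have m0 : 0 < Num.min r d by rewrite lt_min r0.
  move/cvgrPdist_lt : cgh => /(_ _ m0); apply: filterS => u /=.
  rewrite lt_min => /andP[ur ud].
  rewrite [A1 t]/A1 eqxx /A1; have [E|gut] := eqVneq (g u) (g t); first by rewrite subrr normr0.
  have near_ (z : R) : `|z - g t| <= `|g u - g t| -> forall m : R, `|p - (g u, h u)| < m -> `|p - (z, h u)| < m.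
    move=> zt m; rewrite !norm_pair_lt /= => /andP[h1 ->]; rewrite andbT distrC.
    by rewrite (le_lt_trans zt)// distrC.
  have [c ct E] := @MVT_any R (fun u' => f (u', h u)) (fun u' => fx (u', h u)) (g t) (g u)
    (fun z zt => dfx (z, h u) (near_ z zt r ur)).
  rewrite E mulfK ?subr_eq0//; apply: dP; rewrite -ball_normE /=; exact: near_.
have cA2 : {for t, continuous A2}.
  apply/cvgrPdist_lt => e e0.
  move/cvgrPdist_lt : cfy => /(_ e e0) /nbhs_ballP[d /= d0 dP].
  have m0 : 0 < Num.min r d by rewrite lt_min r0.
  move/cvgrPdist_lt : cgh => /(_ _ m0); apply: filterS => u /=.
  rewrite lt_min => /andP[ur ud].
  rewrite [A2 t]/A2 eqxx /A2; have [E|hut] := eqVneq (h u) (h t); first by rewrite subrr normr0.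
  have near_ (z : R) : `|z - h t| <= `|h u - h t| -> forall m : R, `|p - (g u, h u)| < m -> `|p - (g t, z)| < m.
    move=> zt m m_; have m0' : 0 < m by exact: le_lt_trans m_.
    move: m_; rewrite !norm_pair_lt /= => /andP[_ h1]; rewrite subrr normr0 m0' /= distrC.
    by rewrite (le_lt_trans zt)// distrC.
  have [c ct E] := @MVT_any R (fun v => f (g t, v)) (fun v => fy (g t, v)) (h t) (h u)
    (fun z zt => dfy (g t, z) (near_ z zt r ur)).
  rewrite E mulfK ?subr_eq0//; apply: dP; rewrite -ball_normE /=; exact: near_.
have -> : fx (g t, h t) * g' + fy (g t, h t) * h' = (fun u => A1 u * Ag u + A2 u * Ah u) t.
  by rewrite /A1 /A2 !eqxx Agt Aht.
apply: (@caratheodory_isd _ (fun u => A1 u * Ag u + A2 u * Ah u)); last by apply: cvgD; apply: cvgM.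
move=> u; have E1 : f (g u, h u) - f (g t, h u) = A1 u * (g u - g t).
  rewrite /A1; have [->|gut] := eqVneq (g u) (g t); first by rewrite !subrr mulr0.
  by rewrite divfK// subr_eq0.
have E2 : f (g t, h u) - f (g t, h t) = A2 u * (h u - h t).
  rewrite /A2; have [->|gut] := eqVneq (h u) (h t); first by rewrite !subrr mulr0.
  by rewrite divfK// subr_eq0.
rewrite mulrDl -!mulrA -EAg -EAh -E1 -E2; ring.
Qed.

(** The second difference of [f] over a square of side [h], evaluated by the mean value theorem in
    both orders, equates [fxy] and [fyx] at two points within [h] of [p]. If they differed at [p],
    continuity with [e] half the gap would forbid this. *)
Lemma schwarz (f fx fy fxy fyx : R * R -> R) (p : R * R) (r : R) : 0 < r ->
  (forall q : R * R, `|p - q| < r -> is_derive q.1 1 (fun u => f (u, q.2)) (fx q)) ->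
  (forall q : R * R, `|p - q| < r -> is_derive q.2 1 (fun v => f (q.1, v)) (fy q)) ->
  (forall q : R * R, `|p - q| < r -> is_derive q.2 1 (fun v => fx (q.1, v)) (fxy q)) ->
  (forall q : R * R, `|p - q| < r -> is_derive q.1 1 (fun u => fy (u, q.2)) (fyx q)) ->
  {for p, continuous fxy} -> {for p, continuous fyx} -> fxy p = fyx p.
Proof.
move=> r0 dfx dfy dfxy dfyx cxy cyx.
apply/eqP/negPn/negP => ne.
pose e := `|fxy p - fyx p| / 2.
have e0 : 0 < e by rewrite divr_gt0// normr_gt0 subr_eq0.
move/cvgrPdist_lt : cxy => /(_ e e0) /nbhs_ballP[d1 /= d10 P1].
move/cvgrPdist_lt : cyx => /(_ e e0) /nbhs_ballP[d2 /= d20 P2].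
pose h := Num.min r (Num.min d1 d2) / 2.
have m0 : 0 < Num.min r (Num.min d1 d2) by rewrite !lt_min r0 d10.
have h0 : 0 < h by rewrite divr_gt0.
have hm : h < Num.min r (Num.min d1 d2) by rewrite /h; lra.
move: hm; rewrite !lt_min => /andP[hr /andP[hd1 hd2]].
have box (u v : R) : `|u - p.1| <= h -> `|v - p.2| <= h -> `|p - (u, v)| <= h.
  by move=> u1 v1; rewrite norm_pair_le /= ![`|_ - u|]distrC ![`|_ - v|]distrC u1.
have hh (z c : R) : `|z - c| <= `|c + h - c| -> `|z - c| <= h.
  by rewrite [c + h]addrC addrK (gtr0_norm h0).
have c1 (c : R) : `|c + h - c| <= h by rewrite [c + h]addrC addrK (gtr0_norm h0).
have c0 (c : R) : `|c - c| <= h by rewrite subrr normr0 ltW.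
have rr u v : `|u - p.1| <= h -> `|v - p.2| <= h -> `|p - (u, v)| < r.
  by move=> ? ?; apply: le_lt_trans hr; exact: box.
have [u1 u1p E1] := @MVT_any R (fun u => f (u, p.2 + h) + -1 * f (u, p.2))
  (fun u => fx (u, p.2 + h) + -1 * fx (u, p.2)) p.1 (p.1 + h)
  (fun z zp => isd_add (dfx (z, p.2 + h) (rr _ _ (hh _ _ zp) (c1 _)))
     (isd_scale (-1) (dfx (z, p.2) (rr _ _ (hh _ _ zp) (c0 _))))).
have [v1 v1p E2] := @MVT_any R (fun v => fx (u1, v)) (fun v => fxy (u1, v)) p.2 (p.2 + h)
  (fun z zp => dfxy (u1, z) (rr _ _ (hh _ _ u1p) (hh _ _ zp))).
have [v2 v2p E3] := @MVT_any R (fun v => f (p.1 + h, v) + -1 * f (p.1, v))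
  (fun v => fy (p.1 + h, v) + -1 * fy (p.1, v)) p.2 (p.2 + h)
  (fun z zp => isd_add (dfy (p.1 + h, z) (rr _ _ (c1 _) (hh _ _ zp)))
     (isd_scale (-1) (dfy (p.1, z) (rr _ _ (c0 _) (hh _ _ zp))))).
have [u2 u2p E4] := @MVT_any R (fun u => fy (u, v2)) (fun u => fyx (u, v2)) p.1 (p.1 + h)
  (fun z zp => dfyx (z, v2) (rr _ _ (hh _ _ zp) (hh _ _ v2p))).
have E : fxy (u1, v1) = fyx (u2, v2).
  have h2 : h ^+ 2 != 0 by rewrite sqrf_eq0 gt_eqF.
  apply: (mulIf h2).
  have e2 : fx (u1, p.2 + h) + -1 * fx (u1, p.2) = fxy (u1, v1) * h by rewrite mulN1r E2; ring.
  have e4 : fy (p.1 + h, v2) + -1 * fy (p.1, v2) = fyx (u2, v2) * h by rewrite mulN1r E4; ring.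
  rewrite e2 in E1; rewrite e4 in E3.
  transitivity (fxy (u1, v1) * h * (p.1 + h - p.1)); first by ring.
  rewrite -E1; transitivity (fyx (u2, v2) * h * (p.2 + h - p.2)); last by ring.
  by rewrite -E3; ring.
have k1 : `|fxy p - fxy (u1, v1)| < e.
  by apply: P1; rewrite -ball_normE /=; apply: le_lt_trans hd1; apply: box; apply: hh.
have k2 : `|fyx p - fyx (u2, v2)| < e.
  by apply: P2; rewrite -ball_normE /=; apply: le_lt_trans hd2; apply: box; apply: hh.
have : `|fxy p - fyx p| < e + e.
  have -> : fxy p - fyx p = (fxy p - fxy (u1, v1)) - (fyx p - fyx (u2, v2)) by rewrite E; ring.
  by rewrite (le_lt_trans (ler_normB _ _))// ltrD.
by rewrite /e; lra.
Qed.

Lemma isd_unique (f : R -> R) (t l m : R) : is_derive t 1 f l -> is_derive t 1 f m -> l = m.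
Proof. by move=> /@derive_val <- /@derive_val <-. Qed.

Lemma near_isd (f g : R -> R) (t l : R) : (\forall s \near t, f s = g s) ->
  is_derive t 1 f l -> is_derive t 1 g l.
Proof. exact: near_eq_is_derive. Qed.

Lemma isd_derive1 (f : R -> R) (t l : R) : is_derive t 1 f l -> derive1 f t = l.
Proof. by move=> /@derive_val <-; rewrite derive1E. Qed.

Lemma derivable_isd (f : R -> R) (t : R) : derivable f t 1 -> is_derive t 1 f (derive1 f t).
Proof. by move=> /derivableP; rewrite derive1E. Qed.

Section Smooth.
Variables (U : set (R * R)) (H : R * R -> R).
Hypotheses (oU : open U) (sH : smooth_on U H).

Lemma open_norm (p : R * R) : U p -> exists2 r : R, 0 < r & forall q : R * R, `|p - q| < r -> U q.
Proof.
move=> Up; have /nbhs_ballP[r /= r0 rP] : nbhs p U by exact: open_nbhs_nbhs.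
by exists r => // q pq; apply: rP; rewrite -ball_normE.
Qed.

Lemma smooth_dx (w : seq bool) (p : R * R) : U p ->
  is_derive p.1 1 (fun u => iter_partial w H (u, p.2)) (iter_partial (true :: w) H p).
Proof. by move=> /(sH w)[h _ _]; exact: derivable_isd. Qed.

Lemma smooth_dy (w : seq bool) (p : R * R) : U p ->
  is_derive p.2 1 (fun v => iter_partial w H (p.1, v)) (iter_partial (false :: w) H p).
Proof. by move=> /(sH w)[_ h _]; exact: derivable_isd. Qed.

Lemma smooth_cont (w : seq bool) (p : R * R) : U p -> {for p, continuous (iter_partial w H)}.
Proof. by move=> /(sH w)[]. Qed.

Lemma smooth_chain (w : seq bool) (g h : R -> R) (t g' h' : R) : U (g t, h t) ->
  is_derive t 1 g g' -> is_derive t 1 h h' ->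
  is_derive t 1 (fun u => iter_partial w H (g u, h u))
    (iter_partial (true :: w) H (g t, h t) * g' + iter_partial (false :: w) H (g t, h t) * h').
Proof.
move=> Up gd hd; have [r r0 rU] := open_norm Up.
by apply: (chain2 r0) => // [q /rU|q /rU| |]; [exact: smooth_dx|exact: smooth_dy|exact: smooth_cont|exact: smooth_cont].
Qed.

Lemma smooth_schwarz (p : R * R) : U p -> dx (dy H) p = dy (dx H) p.
Proof.
move=> Up; have [r r0 rU] := open_norm Up.
apply/esym; apply: (@schwarz H (dx H) (dy H) _ _ p r r0) => [q /rU|q /rU|q /rU|q /rU| |].
- exact: (@smooth_dx [::]).
- exact: (@smooth_dy [::]).
- exact: (@smooth_dy [:: true]).
- exact: (@smooth_dx [:: false]).
- exact: (@smooth_cont [:: false; true]).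
- exact: (@smooth_cont [:: true; false]).
Qed.

Lemma Vfield_cont (p : R * R) : U p -> {for p, continuous (Vfield H)}.
Proof.
move=> Up; apply: cont_pair.
  apply: cvgB; first exact: (@smooth_cont [:: false; false]).
  exact: (@smooth_cont [:: true; true]).
apply: cvgN; apply: cvgMr; exact: (@smooth_cont [:: false; true]).
Qed.

Lemma Vfield_eq0 (p : R * R) : (Vfield H p = 0) <-> conformal_pt H p.
Proof.
rewrite /conformal_pt; split=> [[e1 e2]|[e1 e2]]; first by split; lra.
by rewrite /Vfield e1 e2 subrr mulr0 oppr0.
Qed.

Section Boundary.
Variables (g1 g2 : R -> R).
Hypotheses (sg1 : smooth1 g1) (sg2 : smooth1 g2)
  (unit_speed : forall t, derive1 g1 t ^+ 2 + derive1 g2 t ^+ 2 = 1)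
  (gU : forall t, U (g1 t, g2 t))
  (Hconst : exists c : R, forall t, H (g1 t, g2 t) = c)
  (gV : forall t, ~ conformal_pt H (g1 t, g2 t)).

Let Hts := fun (t s : R) => H (g1 t - s * derive1 g2 t, g2 t + s * derive1 g1 t).
Let k := fun (t : R) => derive1 g1 t * derive1n 2 g2 t - derive1 g2 t * derive1n 2 g1 t.

(* The left-hand side is the real part of [V] divided by the square of the unit
   tangent. It equals [H_ss + k H_s]; under the second condition the gradient
   vanishes along the curve, so the Hessian is a multiple of the projection onto
   the normal, and vanishes with this number. *)
Lemma boundary_normal :
  (forall t, derive1n 2 (Hts t) 0 + k t * derive1 (Hts t) 0 != 0)
   \/ (forall t, derive1 (Hts t) 0 = 0) ->
  forall t, (Vfield H (g1 t, g2 t)).1 * (derive1 g1 t ^+ 2 - derive1 g2 t ^+ 2)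
    + (Vfield H (g1 t, g2 t)).2 * (2 * derive1 g1 t * derive1 g2 t) != 0.
Proof.
have dg1 (t : R) : is_derive t 1 g1 (derive1 g1 t) by apply: derivable_isd; exact: (@sg1 0%N t).
have dg2 (t : R) : is_derive t 1 g2 (derive1 g2 t) by apply: derivable_isd; exact: (@sg2 0%N t).
have ddg1 (t : R) : is_derive t 1 (derive1 g1) (derive1n 2 g1 t) by apply: derivable_isd; exact: (@sg1 1%N t).
have ddg2 (t : R) : is_derive t 1 (derive1 g2) (derive1n 2 g2 t) by apply: derivable_isd; exact: (@sg2 1%N t).
set a := derive1 g1 in dg1 ddg1 *; set b := derive1 g2 in dg2 ddg2 *.
set a2 := derive1n 2 g1 in ddg1 *; set b2 := derive1n 2 g2 in ddg2 *.
pose P (t : R) := (g1 t, g2 t).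
have cst0 (f : R -> R) (c t l : R) : (forall u, f u = c) -> is_derive t 1 f l -> l = 0.
  move=> fc fl; apply: (isd_unique fl).
  have -> : f = cst c by apply/funext.
  exact: is_derive_cst.
have e5 (t : R) : a t * a2 t + b t * b2 t = 0.
  have := cst0 _ _ t _ unit_speed (isd_add (isd_sqr (ddg1 t)) (isd_sqr (ddg2 t))).
  by rewrite -/a -/b; lra.
have e1 (t : R) : dx H (P t) * a t + dy H (P t) * b t = 0.
  have [c Hc] := Hconst.
  exact: cst0 _ _ t _ Hc (@smooth_chain [::] g1 g2 t _ _ (gU t) (dg1 t) (dg2 t)).
have dHx (t : R) := @smooth_chain [:: true] g1 g2 t _ _ (gU t) (dg1 t) (dg2 t).
have dHy (t : R) := @smooth_chain [:: false] g1 g2 t _ _ (gU t) (dg1 t) (dg2 t).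
rewrite /= in dHx dHy.
have e2 (t : R) := cst0 _ _ t _ e1 (isd_add (isd_mul (dHx t) (ddg1 t)) (isd_mul (dHy t) (ddg2 t))).
pose n1 (t s : R) := g1 t - s * b t; pose n2 (t s : R) := g2 t + s * a t.
have dn1 (t s : R) : is_derive s 1 (n1 t) (- b t).
  have -> : n1 t = (fun s => (- b t) * s + g1 t) by apply/funext => u; rewrite /n1; ring.
  by apply: (isd_eq (isd_addc _ (isd_scale _ (is_derive_id s 1)))); rewrite mulr1.
have dn2 (t s : R) : is_derive s 1 (n2 t) (a t).
  have -> : n2 t = (fun s => a t * s + g2 t) by apply/funext => u; rewrite /n2; ring.
  by apply: (isd_eq (isd_addc _ (isd_scale _ (is_derive_id s 1)))); rewrite mulr1.
have n0 (t : R) : (n1 t 0, n2 t 0) = P t by rewrite /n1 /n2 /P !mul0r subr0 addr0.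
have dF (t s : R) : U (n1 t s, n2 t s) ->
    is_derive s 1 (Hts t) (dx H (n1 t s, n2 t s) * (- b t) + dy H (n1 t s, n2 t s) * a t).
  by move=> Us; exact: (@smooth_chain [::] (n1 t) (n2 t) s _ _ Us (dn1 t s) (dn2 t s)).
have e3 (t : R) : derive1 (Hts t) 0 = dx H (P t) * (- b t) + dy H (P t) * a t.
  by have := dF t 0; rewrite n0 => /(_ (gU t)) /isd_derive1.
have e4 (t : R) : derive1n 2 (Hts t) 0 =
    (dx (dx H) (P t) * (- b t) + dy (dx H) (P t) * a t) * (- b t)
    + (dx (dy H) (P t) * (- b t) + dy (dy H) (P t) * a t) * a t.
  apply: isd_derive1.
  have Un0 : U (n1 t 0, n2 t 0) by rewrite n0; exact: gU.
  have h1 := @smooth_chain [:: true] (n1 t) (n2 t) 0 _ _ Un0 (dn1 t 0) (dn2 t 0).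
  have h2 := @smooth_chain [:: false] (n1 t) (n2 t) 0 _ _ Un0 (dn1 t 0) (dn2 t 0).
  rewrite /= in h1 h2.
  have := isd_add (isd_scale (- b t) h1) (isd_scale (a t) h2).
  rewrite n0 => h3.
  have cn : {for 0, continuous (fun s : R => (n1 t s, n2 t s))}.
    by apply: cont_pair; apply: differentiable_continuous; apply/derivable1_diffP; apply: ex_derive.
  (* The second normal derivative needs the first one on a neighbourhood of s = 0, where the normal
     line is still in [U]. *)
  have hn : \forall s \near (0 : R),
      - b t * dx H (n1 t s, n2 t s) + a t * dy H (n1 t s, n2 t s) = derive1 (Hts t) s.
    have : \forall s \near (0 : R), U (n1 t s, n2 t s).
      by apply: cn; exact: open_nbhs_nbhs.
    apply: filterS => s Us; rewrite (isd_derive1 (dF t s Us)) mulrC; congr (_ + _).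
    exact: mulrC.
  by apply: (isd_eq (near_isd hn h3)); rewrite mulrC; congr (_ + _); exact: mulrC.
have sw (t : R) := smooth_schwarz (gU t).
have V1 p : (Vfield H p).1 = dy (dy H) p - dx (dx H) p by [].
have V2 p : (Vfield H p).2 = - (2 * dy (dx H) p) by [].
move=> cond t; rewrite V1 V2 -/(P t) -/(a t) -/(b t).
have {}sw : dx (dy H) (P t) = dy (dx H) (P t) by exact: sw.
have ab := unit_speed t; rewrite -/(a t) -/(b t) in ab.
case: cond => [/(_ t)|cond].
  move=> ne; apply: contraNneq ne => E; apply/eqP.
  rewrite e3 e4 /k -/(a t) -/(b t) -/(a2 t) -/(b2 t).
  move: (e1 t) (e2 t) (e5 t); rewrite /= -/(P t) sw.
  move: E ab; clear; move: (dx (dx H) (P t)) (dy (dy H) (P t)) (dy (dx H) (P t)) (dx H (P t)) (dy H (P t)).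
  move: (a t) (b t) (a2 t) (b2 t) => {}a {}b {}a2 {}b2 A B C X Y E ab E1 E2 E5.
  (* The acceleration is [k] times the normal, so k H_s is the derivative of [H] along the
     acceleration. This term also occurs in the second derivative of [H] along the curve, which is 0
     and is subtracted. *)
  have kF : (a * b2 - b * a2) * (X * - b + Y * a) = X * a2 + Y * b2.
    transitivity ((a ^+ 2 + b ^+ 2) * (X * a2 + Y * b2) - (a * X + b * Y) * (a * a2 + b * b2)).
      by ring.
    by rewrite ab E5; ring.
  by rewrite kF; lra.
have z (t' : R) : dx H (P t') = 0 /\ dy H (P t') = 0.
  have := cond t'; rewrite e3 => c1; have c2 := e1 t'; have := unit_speed t'.
  rewrite -/(a t') -/(b t') => ab'; split.
    transitivity ((a t' ^+ 2 + b t' ^+ 2) * dx H (P t')); first by rewrite ab' mul1r.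
    transitivity (a t' * (dx H (P t') * a t' + dy H (P t') * b t') - b t' * (dx H (P t') * - b t' + dy H (P t') * a t')); first by ring.
    by rewrite c1 c2; ring.
  transitivity ((a t' ^+ 2 + b t' ^+ 2) * dy H (P t')); first by rewrite ab' mul1r.
  transitivity (b t' * (dx H (P t') * a t' + dy H (P t') * b t') + a t' * (dx H (P t') * - b t' + dy H (P t') * a t')); first by ring.
  by rewrite c1 c2; ring.
(* Differentiating the vanishing gradient along the curve: the Hessian annihilates the tangent. *)
have z1 := cst0 _ _ t _ (fun u => (z u).1) (dHx t).
have z2 := cst0 _ _ t _ (fun u => (z u).2) (dHy t).
rewrite /= -/(P t) ?sw in z1 z2.
apply/eqP => E; apply: (gV (t := t)); rewrite -/(P t) /conformal_pt /Hxx /Hyy /Hxy.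
move: z1 z2 E ab; clear; move: (dx (dx H) (P t)) (dy (dy H) (P t)) (dy (dx H) (P t)) (a t) (b t).
move=> A B C {}a {}b z1 z2 E ab.
have EA : A = (A + B) * b ^+ 2.
  transitivity (A * (a ^+ 2 + b ^+ 2) - a * (A * a + C * b) + b * (C * a + B * b)); last by ring.
  by rewrite ab z1 z2; ring.
have EB : B = (A + B) * a ^+ 2.
  transitivity (B * (a ^+ 2 + b ^+ 2) + a * (A * a + C * b) - b * (C * a + B * b)); last by ring.
  by rewrite ab z1 z2; ring.
have EC : C = - (A + B) * (a * b).
  transitivity (C * (a ^+ 2 + b ^+ 2) - b * (A * a + C * b) - a * (C * a + B * b)); last by ring.
  by rewrite ab z1 z2; ring.
(* By [EA], [EB] and [EC] the number in [E] is (A + B) (a^2 + b^2)^2, so the trace of the Hessian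
   vanishes. *)
have AB0 : A + B = 0.
  transitivity ((A + B) * (a ^+ 2 + b ^+ 2) ^+ 2); first by rewrite ab; ring.
  transitivity (((A + B) * a ^+ 2 - (A + B) * b ^+ 2) * (a ^+ 2 - b ^+ 2) + - (2 * (- (A + B) * (a * b))) * (2 * a * b)); first by ring.
  by rewrite -EA -EB -EC.
by move: EA EB EC; rewrite AB0 oppr0 !mul0r => -> -> ->.
Qed.

End Boundary.
End Smooth.
End Calculus.

(** * Indices of isolated zeros *)

Section Circles.
Variable R : realType.
Implicit Types (p q u v : R * R) (t rho : R).

(** The norm on pairs is the maximum norm, whereas indices are taken on round circles; hence the
    Euclidean triangle inequality for [cmod]. *)
Lemma cmod_tri u v : cmod (u + v) <= cmod u + cmod v.
Proof.
have u0 := cmod_ge0 u; have v0 := cmod_ge0 v; have w0 := cmod_ge0 (u + v).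
have h : dot u v <= cmod u * cmod v.
  have [|d0] := leP (dot u v) 0; first by move=> d0; rewrite (le_trans d0)// mulr_ge0.
  rewrite -ler_sqr ?nnegrE ?mulr_ge0 ?(ltW d0)// exprMn !cmod_sqr.
  have -> : (u.1 ^+ 2 + u.2 ^+ 2) * (v.1 ^+ 2 + v.2 ^+ 2) = dot u v ^+ 2 + crs u v ^+ 2.
    by rewrite /dot /crs; ring.
  by rewrite lerDl sqr_ge0.
rewrite -ler_sqr ?nnegrE ?addr_ge0//.
have -> : (cmod u + cmod v) ^+ 2 = cmod u ^+ 2 + cmod v ^+ 2 + 2 * (cmod u * cmod v) by ring.
rewrite !cmod_sqr /=; move: h; rewrite /dot; lra.
Qed.

Lemma cmod0 : cmod (0 : R * R) = 0.
Proof. by rewrite /cmod /= expr0n addr0 sqrtr0. Qed.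

Lemma cmodZ (s : R) u : cmod (s *: u) = `|s| * cmod u.
Proof.
rewrite /cmod -[`|s|]sqrtr_sqr -sqrtrM ?sqr_ge0//; congr Num.sqrt.
by rewrite /= /GRing.scale /=; ring.
Qed.

Lemma cmod_distC u v : cmod (u - v) = cmod (v - u).
Proof. by rewrite -cmodN opprB. Qed.

Lemma cont_cmod q : continuous (fun z : R * R => cmod (z - q)).
Proof.
move=> z; apply: (@continuous_comp _ _ _ (fun z : R * R => (z - q).1 ^+ 2 + (z - q).2 ^+ 2) Num.sqrt).
  have c : {for z, continuous (fun z : R * R => z - q)} by apply: cvgB; [exact: cvg_id|exact: cvg_cst].
  have c1 := cont_fst c; have c2 := cont_snd c.
  exact: (cvgD (cvgM c1 c1) (cvgM c2 c2)).
exact: sqrt_continuous.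
Qed.

Definition expi t : R * R := (cos (2 * pi * t), sin (2 * pi * t)).
Definition circ p rho t : R * R := (p.1 + rho * cos (2 * pi * t), p.2 + rho * sin (2 * pi * t)).

Lemma circE p rho t : circ p rho t = p + rho *: expi t.
Proof. by []. Qed.

Lemma cmod_expi t : cmod (expi t) = 1.
Proof. by rewrite /cmod /= cos2Dsin2 sqrtr1. Qed.

Lemma circ_dist p rho t : 0 <= rho -> cmod (circ p rho t - p) = rho.
Proof. by move=> r0; rewrite circE addrAC subrr add0r cmodZ cmod_expi mulr1 ger0_norm. Qed.

Lemma cont_expi : continuous expi.
Proof.
move=> t; have c : {for t, continuous (fun t : R => 2 * pi * t)} by apply: cvgMr; exact: cvg_id.
apply: cont_pair.
  by apply: (@continuous_comp _ _ _ (fun t : R => 2 * pi * t) cos) => //; exact: continuous_cos.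
by apply: (@continuous_comp _ _ _ (fun t : R => 2 * pi * t) sin) => //; exact: continuous_sin.
Qed.

Lemma cont_circ (T : topologicalType) p (f g : T -> R) (z : T) : {for z, continuous f} ->
  {for z, continuous g} -> {for z, continuous (fun z => circ p (f z) (g z))}.
Proof.
move=> cf cg.
have e : {for z, continuous (fun y => expi (g y))}.
  by apply: continuous_comp => //; exact: cont_expi.
apply: cont_pair; apply: cvgD; [exact: cvg_cst|exact: (cvgM cf (cont_fst e))|
  exact: cvg_cst|exact: (cvgM cf (cont_snd e))].
Qed.

Lemma circ1 p rho : circ p rho 1 = circ p rho 0.
Proof. by rewrite /circ mulr1 mulr0 mulr_natl cos2pi sin2pi cos0 sin0. Qed.

Lemma turn_cst p : p != 0 -> turn (fun _ : R => p) = 0.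
Proof.
move=> p0; have [a pa] := polar_ex p.
have pc : nzpath (fun _ : R => p) by split=> [t|//]; exact: cvg_cst.
have il : is_lift (fun _ : R => p) (fun _ => a) by split=> [t _|//]; exact: cvg_cst.
by rewrite (turnE pc il) subrr.
Qed.

Lemma turn_expi : turn expi = 2 * pi.
Proof.
rewrite (@turnE R _ (fun t => 2 * pi * t)); first by rewrite mulr1 mulr0 subr0.
  by split; [exact: cont_expi|move=> t _; rewrite -cmod_gt0 cmod_expi].
split=> t _; first by apply: cvgMr; exact: cvg_id.
by rewrite /polar cmod_expi !mul1r.
Qed.

Lemma turn_scale (s : R) (c : R -> R * R) : 0 < s -> nzpath c -> turn (fun t => s *: c t) = turn c.
Proof.
move=> s0 pc; have ps : nzpath (fun _ : R => (s, 0)).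
  by split=> [t|t _]; [exact: cvg_cst|rewrite pair_eq0 /= negb_and gt_eqF].
have -> : (fun t => s *: c t) = (fun t => cmul (s, 0) (c t)).
  by apply/funext => t; rewrite /cmul /=; apply/eqP; rewrite -pair_eqE /= /GRing.scale /= !mul0r subr0 addr0 !eqxx.
rewrite turn_mul// turn_cst ?add0r// pair_eq0 /= negb_and gt_eqF//.
Qed.

(** The point [q] is moved along a segment to the centre, staying inside the circle. *)
Lemma turn_circ_in p q rho : cmod (q - p) < rho -> turn (fun t => circ p rho t - q) = 2 * pi.
Proof.
move=> qp; have r0 : 0 < rho by exact: le_lt_trans (cmod_ge0 _) qp.
pose F (z : R * R) := circ p rho z.2 - (p + z.1 *: (q - p)).
have := @turn_homotopy R F.
have -> : (fun t => F (1, t)) = (fun t => circ p rho t - q).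
  by apply/funext => t; rewrite /F /= scale1r [p + _]addrC subrK.
have -> : (fun t => F (0, t)) = (fun t => rho *: expi t).
  by apply/funext => t; rewrite /F /= scale0r addr0 circE addrAC subrr add0r.
rewrite turn_scale// ?turn_expi; last first.
  by split; [exact: cont_expi|move=> t _; rewrite -cmod_gt0 cmod_expi].
move=> -> //.
- move=> z; apply: cvgB; first by apply: (@cont_circ _ p (fun _ => rho) snd z); [exact: cvg_cst|exact: cvg_snd].
  apply: cvgD; first exact: cvg_cst.
  by apply: cvgZl; exact: cvg_fst.
- move=> [s t] [/= /andP[s0 s1] _]; apply/eqP => E.
  have := circ_dist p t (ltW r0).
  have -> : circ p rho t - p = s *: (q - p) by apply/eqP; rewrite subr_eq addrC -subr_eq0 -/(F (s, t)) E.
  rewrite cmodZ ger0_norm// => h; have := cmod_ge0 (q - p); nra.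
- by move=> s _; rewrite /F /= circ1.
Qed.

(** The circle is shrunk to its centre without meeting [q]. *)
Lemma turn_circ_out p q rho : 0 <= rho < cmod (q - p) -> turn (fun t => circ p rho t - q) = 0.
Proof.
move=> /andP[r0 qp].
pose F (z : R * R) := circ p (z.1 * rho) z.2 - q.
have := @turn_homotopy R F.
have -> : (fun t => F (1, t)) = (fun t => circ p rho t - q).
  by apply/funext => t; rewrite /F /= mul1r.
have -> : (fun t => F (0, t)) = (fun t => p - q).
  by apply/funext => t; rewrite /F /= mul0r circE scale0r addr0.
rewrite turn_cst; last by rewrite -cmod_gt0 cmod_distC (le_lt_trans r0).
move=> <- //.
- move=> z; have c : {for z, continuous (fun z : R * R => circ p (z.1 * rho) z.2)}.
    by apply: (@cont_circ (R * R)%type p (fun z : R * R => z.1 * rho : R) (@snd R R) z); [apply: cvgMl; exact: cvg_fst|exact: cvg_snd].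
  by apply: (cvgB c); exact: cvg_cst.
- move=> [s t] [/= /andP[s0 s1] _]; rewrite subr_eq0; apply/eqP => E.
  have := @circ_dist p (s * rho) t (mulr_ge0 s0 r0); rewrite E; nra.
- by move=> s _; rewrite /F /= circ1.
Qed.

(** Extends data on [0, 1] to the line: [has_index] asks for a lift continuous everywhere, and
    [turn_homotopy] for a map continuous on the whole plane. *)
Definition clamp (t : R) : R := Num.max 0 (Num.min 1 t).

Lemma clamp_unit t : unit_itv (clamp t).
Proof. by rewrite /unit_itv /clamp /= le_max lexx /= ge_max ler01 ge_min lexx. Qed.

Lemma clampE t : unit_itv t -> clamp t = t.
Proof. by move=> /andP[t0 t1]; rewrite /clamp (min_idPr t1) (max_idPr t0). Qed.

Lemma cont_clamp : continuous clamp.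
Proof.
move=> t; apply: continuous_max; first exact: cvg_cst.
by apply: continuous_min; [exact: cvg_cst|exact: cvg_id].
Qed.

(** All circles around [p] of radius below [r] are homotopic where [V] is nonzero, so the integer
    found at radius [r / 2] serves for each of them. *)
Lemma has_index_circ (V : R * R -> R * R) p (r : R) : 0 < r ->
  (forall q, cmod (q - p) < r -> {for q, continuous V}) ->
  (forall q, cmod (q - p) < r -> V q = 0 -> q = p) ->
  exists2 n : int, has_index V p n &
    forall rho, 0 < rho < r -> turn (V \o circ p rho) = 2 * pi * n%:~R.
Proof.
move=> r0 cV V0.
have near_ rho t : 0 < rho < r -> cmod (circ p rho t - p) < r.
  by move=> /andP[? ?]; rewrite circ_dist// ltW.
have nz rho t : 0 < rho < r -> V (circ p rho t) != 0.
  move=> hr; apply/eqP => /(V0 _ (near_ _ t hr)) E; have /andP[h0 _] := hr.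
  by have := circ_dist p t (ltW h0); rewrite E subrr cmod0 => h; rewrite -h ltxx in h0.
have lp rho : 0 < rho < r -> loop (V \o circ p rho).
  move=> hr; split; last by rewrite /= circ1.
  split=> t; last by move=> _; exact: nz.
  apply: continuous_comp; last by apply: cV; exact: near_.
  by apply: (@cont_circ _ p (fun _ => rho) id t); [exact: cvg_cst|exact: cvg_id].
have h2 : 0 < r / 2 < r by rewrite divr_gt0//=; lra.
have [n nE] := turn_int (lp _ h2).
have same_ rho : 0 < rho < r -> turn (V \o circ p rho) = 2 * pi * n%:~R.
  move=> /andP[rho0 rhor]; rewrite -nE.
  pose rr (s : R) := r / 2 + clamp s * (rho - r / 2).
  have rrb s : 0 < rr s < r.
    have /andP[c0 c1] := clamp_unit s.
    have -> : rr s = (1 - clamp s) * (r / 2) + clamp s * rho by rewrite /rr; ring.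
    apply/andP; split.
      have [->|cn] := eqVneq (clamp s) 0; first by lra.
      by rewrite ltr_wpDl ?mulr_ge0 ?subr_ge0 ?(ltW r0) ?mulr_gt0 ?invr_ge0// lt_neqAle eq_sym cn.
    have : (1 - clamp s) * (r / 2) <= (1 - clamp s) * r by rewrite ler_wpM2l ?subr_ge0//; lra.
    have [->|cn] := eqVneq (clamp s) 0; first by lra.
    have : clamp s * rho < clamp s * r by rewrite ltr_pM2l// lt_neqAle eq_sym cn.
    lra.
  have rr0 : rr 0 = r / 2 by rewrite /rr (clampE (@unit0 R)) mul0r addr0.
  have rr1 : rr 1 = rho by rewrite /rr (clampE (@unit1 R)) mul1r addrC subrK.
  have := @turn_homotopy R (fun z => V (circ p (rr z.1) z.2)).
  rewrite /= rr0 rr1 => ->//.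
  - move=> z; apply: (@continuous_comp _ _ _ (fun z : R * R => circ p (rr z.1) z.2)); last by apply: cV; exact: near_.
    apply: (@cont_circ _ p (fun z => rr z.1) snd z); last exact: cvg_snd.
    apply: cvgD; first exact: cvg_cst.
    by apply: cvgMl; apply: continuous_comp; [exact: cvg_fst|exact: cont_clamp].
  - by move=> [s t] _; apply: nz; exact: rrb.
  - by move=> s _; rewrite circ1.
exists n => //; exists r; split=> // rho hr /=.
split=> [t _|]; first exact: (nz rho t hr).
have [[cc c0] _] := lp rho hr.
have [th [cth pth] E] := nzpath_lift (conj cc c0).
exists (th \o clamp); split.
  by move=> t; apply: continuous_comp; [exact: cont_clamp|apply: cth; exact: clamp_unit].
split=> [t t01|]; first by rewrite /= (clampE t01); exact: (pth t t01).
by rewrite /= (clampE (@unit0 R)) (clampE (@unit1 R)) -E same_.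
Qed.

(** The real part keeps its sign, by the intermediate value theorem, so [c] or its opposite stays in
    the right half-plane. *)
Lemma turn_re_neq0 (c : R -> R * R) : continuous c -> c 1 = c 0 ->
  (forall t, (c t).1 != 0) -> turn c = 0.
Proof.
move=> cc c10 c1.
have key (d : R -> R * R) : continuous d -> d 1 = d 0 -> (forall t : R, (d t).1 != 0) -> 0 < (d 0).1 -> turn d = 0.
  move=> cd d10 d1 d0; apply: turn_slit => // t /andP[t0 t1]; rewrite cmod_slit; apply/orP; right.
  rewrite lt_neqAle eq_sym d1 leNgt /=; apply/negP => dt.
  have wf : {within [set` `[0, t]], continuous (fun w : R => (d w).1)}.
    by apply: continuous_subspaceT => w; exact: (cont_fst (cd w)).
  have [|z _ dz] := @IVT R (fun w : R => (d w).1) 0 t 0 t0 wf.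
    by rewrite ge_min le_max (ltW d0) (ltW dt) orbT.
  by have := d1 z; rewrite dz eqxx.
have [c0|c0] := ltP 0 (c 0).1; first exact: key.
rewrite -turn_opp; last first.
  by split=> // t _; rewrite pair_eq0 negb_and c1.
apply: key => [t||t|].
- by apply: cvgN; exact: cc.
- by rewrite c10.
- by rewrite /= oppr_eq0.
- by rewrite /= oppr_gt0 lt_neqAle c1.
Qed.

End Circles.

(** * Finiteness of the zeros and the sum of their indices *)

Section Index.
Variable R : realType.

(** Near-covering compactness for the filter of all sufficiently large finite lists: locally it is
    enough to list one point, so one list contains all of [Z]. *)
Lemma finite_isolated (D Z : set (R * R)) : compact D -> Z `<=` D ->
  (forall p, D p -> exists B : set (R * R), [/\ open B, B p & forall q, B q -> Z q -> q = p]) ->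
  exists2 s : seq (R * R), uniq s & forall p, Z p <-> p \in s.
Proof.
move=> cD ZD isol.
pose F : set_system (seq (R * R)) := 
  [set S | exists s0 : seq (R * R), forall s : seq (R * R), {subset s0 <= s} -> S s].
have FF : Filter F.
  split=> [|S1 S2 [s1 h1] [s2 h2]|S1 S2 S12 [s1 h1]]; first by exists [::].
    by exists (s1 ++ s2) => s ss; split; [apply: h1|apply: h2] => z zs;
      apply: ss; rewrite mem_cat zs ?orbT.
  by exists s1 => s /h1 /S12.
have [|s0 cov] := (compact_near_coveringP D).1 cD _ F (fun s p => Z p -> p \in s) FF.
  move=> p /isol[B [oB Bp BZ]].
  exists (B, [set s : seq (R * R) | p \in s]); last by move=> [q s] [/= Bq ps] Zq; rewrite (BZ q Bq Zq).
  split; first exact: open_nbhs_nbhs.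
  by exists [:: p] => s; apply; rewrite inE.
exists [seq p <- undup s0 | `[< Z p >]]; first by rewrite filter_uniq// undup_uniq.
move=> p; rewrite mem_filter mem_undup; split=> [Zp|/andP[/asboolP//]].
apply/andP; split; first exact/asboolP.
by apply: (cov s0) => //; exact: ZD.
Qed.

Lemma cmul_unitK (v u : R * R) : u.1 ^+ 2 + u.2 ^+ 2 = 1 ->
  cmul (cmul v (conjp (cmul u u))) (cmul u u) = v.
Proof.
move: v u => [p q] [c d] /= cd; rewrite /cmul /conjp /=.
congr pair.
  by transitivity (p * (c ^+ 2 + d ^+ 2) ^+ 2); [ring|rewrite cd expr1n mulr1].
by transitivity (q * (c ^+ 2 + d ^+ 2) ^+ 2); [ring|rewrite cd expr1n mulr1].
Qed.

Lemma cmod_ball (A : set (R * R)) (p : R * R) : open A -> A p ->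
  exists2 r : R, 0 < r & forall q, cmod (q - p) < r -> A q.
Proof.
move=> oA Ap; have [r r0 rA] := open_norm oA Ap; exists r => // q qp; apply: rA.
have : cmod (q - p) ^+ 2 < r ^+ 2 by rewrite ltr_pXn2r// nnegrE ?cmod_ge0// ltW.
rewrite cmod_sqr norm_pair_lt /= (distrC p.1) (distrC p.2) => h.
by apply/andP; split; rewrite ltr_norml; apply/andP; split;
  have := sqr_ge0 (q.1 - p.1); have := sqr_ge0 (q.2 - p.2); nra.
Qed.

Lemma min_seq (T : eqType) (s : seq T) (f : T -> R) : (forall p, p \in s -> 0 < f p) ->
  exists2 r : R, 0 < r & forall p, p \in s -> r <= f p.
Proof.
elim: s => [|x s IH] fs; first by exists 1.
have [|r r0 rs] := IH; first by move=> p ps; apply: fs; rewrite inE ps orbT.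
exists (Num.min r (f x)); first by rewrite lt_min r0 fs// mem_head.
by move=> p; rewrite inE => /orP[/eqP->|/rs rp]; rewrite ge_min ?lexx ?orbT// rp.
Qed.

(** Remove small open discs around the zeros from [D]. The boundary loop and the small circles run
    in the remaining compact set, so [turn_grid] expresses their turnings with the same weights and
    points, and it remains to compare winding numbers around points outside that set. *)
Lemma turn_index_sum (D : set (R * R)) (V : R * R -> R * R) (G : R -> R * R)
    (s : seq (R * R)) (ind : R * R -> int) (r : R * R -> R) :
  compact D -> continuous G -> G 1 = G 0 -> (forall t, D (G t)) -> (forall t, ~ interior D (G t)) ->
  (forall q, (forall t, q <> G t) ->
     (interior D q /\ turn (fun t => G t - q) = 2 * pi) \/
     (~ interior D q /\ turn (fun t => G t - q) = 0)) ->
  (forall q, D q -> ~ interior D q -> exists t, q = G t) ->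
  (forall p, D p -> {for p, continuous V}) ->
  uniq s -> (forall p, D p -> V p = 0 -> p \in s) ->
  (forall p, p \in s -> [/\ 0 < r p, (forall q, cmod (q - p) < r p -> interior D q),
     (forall q, cmod (q - p) < r p -> V q = 0 -> q = p) &
     V p = 0]) ->
  (forall p, p \in s -> forall rho, 0 < rho < r p -> turn (V \o circ p rho) = 2 * pi * (ind p)%:~R) ->
  turn (V \o G) = 2 * pi * (\sum_(p <- s) ind p)%:~R.
Proof.
move=> cD cG G10 DG GD cls bd cV us sV rP indP.
have [rho0 rho00 rhor] := min_seq (fun p ps => let: And4 h _ _ _ := rP p ps in h).
(* Distinct zeros are at least [2 * rho] apart, so the open discs of radius [rho] are disjoint and
   each circle avoids the other discs. *)
pose rho := rho0 / 2; have rho_gt0 : 0 < rho by rewrite divr_gt0.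
have rho2 p : p \in s -> rho < r p /\ 2 * rho <= r p.
  by move=> /rhor h; rewrite /rho; split; lra.
have disc p q : p \in s -> cmod (q - p) < r p -> interior D q by move=> /rP[_ + _ _]; apply.
have sep p p' : p \in s -> p' \in s -> p' != p -> r p <= cmod (p' - p).
  move=> ps p's ne; rewrite leNgt; apply/negP => lt.
  have [_ _ V0 _] := rP p ps; have [_ _ _ Vp'] := rP p' p's.
  by rewrite (V0 p' lt Vp') eqxx in ne.
pose K := D `&` [set q | forall p, p \in s -> rho <= cmod (q - p)].
have cK : compact K.
  apply: compact_closedI => //.
  have -> : [set q | forall p, p \in s -> rho <= cmod (q - p)] =
      \bigcap_(p in [set p | p \in s]) [set q | rho <= cmod (q - p)] by [].
  apply: closed_bigI => p _.
  have -> : [set q | rho <= cmod (q - p)] = (fun q => cmod (q - p)) @^-1` [set y | rho <= y] by [].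
  by apply: closed_comp => [w _|]; [exact: cont_cmod|exact: closed_ge].
have KV z : K z -> V z != 0.
  move=> [Dz far]; apply/eqP => /(sV z Dz) /far; rewrite subrr cmod0; lra.
have [I [m [q [qK turnK]]]] := turn_grid cK (fun z Kz => cV z (proj1 Kz)) KV.
have KG t : K (G t).
  split=> [|p ps]; first exact: DG.
  rewrite leNgt; apply/negP => lt; apply: (GD t); apply: (disc p) => //.
  by have [h _] := rho2 p ps; exact: lt_trans h.
have Kc p t : p \in s -> K (circ p rho t).
  move=> ps; have [h1 h2] := rho2 p ps; have cd := circ_dist p t (ltW rho_gt0).
  split=> [|p' p's]; first by apply: interior_subset; apply: (disc p) => //; rewrite cd.
  have [->|ne] := eqVneq p' p; first by rewrite cd.
  have := sep _ _ ps p's ne.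
  have -> : p' - p = (circ p rho t - p) + (p' - circ p rho t).
    by rewrite [RHS]addrC addrA subrK.
  have := cmod_tri (circ p rho t - p) (p' - circ p rho t).
  rewrite cd [cmod (p' - circ _ _ _)]cmod_distC; lra.
have cc p : continuous (circ p rho).
  by move=> t; apply: (@cont_circ R R p (fun _ => rho) id t); [exact: cvg_cst|exact: cvg_id].
(* A point with nonzero weight is either in exactly one of the discs, where both sides are 2 pi, or
   outside [D], where both are 0. *)
have main i : m i != 0 -> turn (fun t => G t - q i) = \sum_(p <- s) turn (fun t => circ p rho t - q i).
  move=> mi; have nK := qK i mi.
  have nG t : q i <> G t by move=> E; apply: nK; rewrite E; exact: KG.
  have out p : p \in s -> rho < cmod (q i - p) -> turn (fun t => circ p rho t - q i) = 0.
    by move=> ps lt; apply: turn_circ_out; rewrite (ltW rho_gt0).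
  have [Dq|nDq] := pselect (D (q i)).
    have /existsNP[p /not_implyP[ps /negP]] : ~ forall p, p \in s -> rho <= cmod (q i - p).
      by move=> far; apply: nK.
    rewrite -ltNge => lt; have [h1 h2] := rho2 p ps.
    have [[_ ->]|[nin _]] := cls (q i) nG; last first.
      by case: nin; apply: (disc p) => //; exact: lt_trans h1.
    rewrite (bigD1_seq p)//= turn_circ_in// big_seq_cond big1 ?addr0// => p' /andP[p's ne].
    apply: out => //; have := sep _ _ ps p's ne.
    have -> : p' - p = (q i - p) + (p' - q i) by rewrite [RHS]addrC addrA subrK.
    have := cmod_tri (q i - p) (p' - q i).
    rewrite [cmod (p' - q i)]cmod_distC; lra.
  have [[din _]|[_ ->]] := cls (q i) nG; first by case: nDq; exact: interior_subset.
  rewrite big_seq_cond big1// => p /andP[ps _]; apply: out => //.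
  rewrite ltNge; apply/negP => le; apply: nDq; apply: interior_subset; apply: (disc p) => //.
  by have [h1 _] := rho2 p ps; exact: le_lt_trans h1.
rewrite (turnK G cG G10 KG).
transitivity (\sum_i \sum_(p <- s) m i * turn (fun t => circ p rho t - q i)).
  apply: eq_bigr => i _; rewrite -mulr_sumr.
  by have [->|mi] := eqVneq (m i) 0; rewrite ?mul0r// main.
rewrite exchange_big /= rmorph_sum /= mulr_sumr; apply: eq_big_seq => p ps.
rewrite -(turnK (circ p rho) (cc p) (circ1 p rho))//; last by move=> t; exact: Kc.
by have [h _] := rho2 p ps; apply: indP; rewrite // rho_gt0.
Qed.

End Index.

(** * The theorem: normalizing the curve and comparing the two counts *)

Unset Implicit Arguments.
Set Strict Implicit.

Theorem theorem1 (R : realType)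
  (D : set (R * R)) (U : set (R * R)) (H : R * R -> R)
  (g1 g2 : R -> R) (L : R) :
  (* D : compact domain, closure of its (nonempty, connected) interior *)
  compact D ->
  D = closure (interior D) ->
  interior D !=set0 ->
  connected (interior D) ->
  (* gamma = (g1, g2): smooth closed simple curve, arc length parametrized,
     with period (= length) L, and it is the boundary of D *)
  0 < L ->
  smooth1 g1 -> smooth1 g2 ->
  (forall t, g1 (t + L) = g1 t /\ g2 (t + L) = g2 t) ->
  (forall t u, 0 <= t < L -> 0 <= u < L -> g1 t = g1 u -> g2 t = g2 u -> t = u) ->
  (forall t, derive1 g1 t ^+ 2 + derive1 g2 t ^+ 2 = 1) ->
  closure D `\` interior D = [set (g1 t, g2 t) | t in [set: R]] ->
  (* orientation: the left normal n(t) = (-g2'(t), g1'(t)) points into D *)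
  (forall t, exists2 e : R, 0 < e & forall s : R, 0 < s < e ->
       interior D (g1 t - s * derive1 g2 t, g2 t + s * derive1 g1 t)) ->
  (* H smooth on a neighbourhood U of D, constant on gamma *)
  open U -> D `<=` U -> smooth_on U H ->
  (exists c : R, forall t, H (g1 t, g2 t) = c) ->
  (* solutions of the system in D are isolated, and none lies on gamma *)
  (forall p, D p -> conformal_pt H p ->
     exists2 r : R, 0 < r & forall q, D q -> conformal_pt H q ->
       (q.1 - p.1) ^+ 2 + (q.2 - p.2) ^+ 2 < r ^+ 2 -> q = p) ->
  (forall t, ~ conformal_pt H (g1 t, g2 t)) ->
  (* condition (i) or (ii), with H(t,s) = H(gamma(t) + s n(t)) *)
  (let Hts := fun t s => H (g1 t - s * derive1 g2 t, g2 t + s * derive1 g1 t) in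
   let k := fun t => derive1 g1 t * derive1n 2 g2 t - derive1 g2 t * derive1n 2 g1 t in
   (forall t, derive1n 2 (Hts t) 0 + k t * derive1 (Hts t) 0 != 0)
   \/ (forall t, derive1 (Hts t) 0 = 0)) ->
  (* conclusion: finitely many solutions in the interior of D, whose indices
     (as zeros of V) add up to 2 *)
  exists s : seq (R * R),
    [/\ uniq s,
        (forall p, (interior D p /\ conformal_pt H p) <-> p \in s)
      & exists ind : R * R -> int,
          (forall p, p \in s -> has_index (Vfield H) p (ind p)) /\
          \sum_(p <- s) ind p = 2].

Proof.
move=> cD Dcl ne conn L0 sg1 sg2 per simple unit_speed bdry left_in oU DU sH Hc isol noV cond.
have clD : closed D by apply: compact_closed => //; exact: norm_hausdorff.
have clE : closure D = D by apply/esym; apply/closure_id.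
rewrite clE in bdry.
have Dg t : D (g1 t, g2 t).
  by have [] : (D `\` interior D) (g1 t, g2 t) by rewrite bdry; exists t.
have nDg t : ~ interior D (g1 t, g2 t).
  by have [] : (D `\` interior D) (g1 t, g2 t) by rewrite bdry; exists t.
have bdD p : D p -> ~ interior D p -> exists t, p = (g1 t, g2 t).
  move=> Dp nDp; have : (D `\` interior D) p by [].
  by rewrite bdry => -[t _ <-]; exists t.
have dg1 (t : R) : is_derive t 1 g1 (derive1 g1 t) by apply: derivable_isd; exact: (@sg1 0%N t).
have dg2 (t : R) : is_derive t 1 g2 (derive1 g2 t) by apply: derivable_isd; exact: (@sg2 0%N t).
have cdg1 : continuous (derive1 g1).
  by move=> t; apply: differentiable_continuous; apply/derivable1_diffP; exact: (@sg1 1%N t).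
have cdg2 : continuous (derive1 g2).
  by move=> t; apply: differentiable_continuous; apply/derivable1_diffP; exact: (@sg2 1%N t).
have lower (p : R * R) : interior D p -> exists2 q : R * R, D q & q.2 < p.2.
  move=> ip; have [r r0 rD] := open_norm (open_interior D) ip.
  exists (p.1, p.2 - r / 2); last by rewrite /= gtrBl divr_gt0.
  apply: interior_subset; apply: rD; rewrite norm_pair_lt /= subrr normr0 r0 /=.
  by rewrite opprB addrC subrK gtr0_norm ?divr_gt0//; lra.
(* A lowest point of [D]. Below an interior point there are further points of [D], so it lies on the
   curve. *)
have [p0 Dp0 p0min] : exists2 p0 : R * R, D p0 & forall q, D q -> p0.2 <= q.2.
  have Dne : D !=set0 by have [z /interior_subset Dz] := ne; exists z.
  have cs : {within D, continuous (snd : R * R -> R)}.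
    by apply: continuous_subspaceT => z; exact: cvg_snd.
  have [p0 p0D p0m] := compact_EVT_min Dne cD cs.
  by exists p0 => [|q Dq]; [exact: set_mem|apply: p0m; exact: mem_set].
have [t0 p0E] : exists t0, p0 = (g1 t0, g2 t0).
  by apply: bdD => // /lower[q /p0min]; rewrite leNgt => /negP.
have low q : D q -> g2 t0 <= q.2 by move=> /p0min; rewrite p0E.
have Dlow q : interior D q -> g2 t0 < q.2.
  by move=> /lower[z /low h1 h2]; exact: le_lt_trans h2.
have b0 : derive1 g2 t0 = 0.
  have t0i : t0 \in `]t0 - 1, t0 + 1[ by rewrite in_itv /=; apply/andP; split; lra.
  have := @derive1_at_min _ g2 (t0 - 1) (t0 + 1) t0 ltac:(lra)
    (fun t _ => ex_derive (is_derive := dg2 t)) t0i (fun t _ => low _ (Dg t)).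
  exact: isd_derive1.
(* The left normal at the lowest point is vertical and leads into [D], hence upwards; this rules out
   the tangent (-1, 0). *)
have a0 : derive1 g1 t0 = 1.
  have [e e0 eD] := left_in t0.
  have he : 0 < e / 2 < e by apply/andP; split; lra.
  have /Dlow /= := eD _ he; rewrite ltrDl pmulr_rgt0 ?divr_gt0// => h.
  have /eqP := unit_speed t0; rewrite b0 expr0n addr0 sqrf_eq1 => /orP[/eqP//|/eqP E].
  by rewrite E in h; lra.
(* The curve is restarted at its lowest point and rescaled to period 1. *)
pose ti (t : R) : R := t0 + L * t.
pose x t := g1 (ti t); pose y t := g2 (ti t).
pose a t := derive1 g1 (ti t); pose b t := derive1 g2 (ti t).
have dti (t : R) : is_derive t 1 ti L.
  have -> : ti = (fun t => L * t + t0) by apply/funext => u; rewrite /ti addrC.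
  by apply: (isd_eq (isd_addc _ (isd_scale _ (is_derive_id t 1)))); rewrite mulr1.
have cti : continuous ti.
  by move=> t; apply: differentiable_continuous; apply/derivable1_diffP; apply: ex_derive.
have ti1 t : ti (t + 1) = ti t + L by rewrite /ti mulrDr mulr1 addrA.
have dgp (g : R -> R) : (forall t : R, is_derive t 1 g (derive1 g t)) ->
    (forall t, g (t + L) = g t) -> forall t, derive1 g (t + L) = derive1 g t.
  move=> dg pg t.
  have h : is_derive t 1 (fun u : R => u + L) 1 by exact: (isd_addc L (is_derive_id t 1)).
  have := @is_derive1_comp _ g (fun u : R => u + L) t _ _ (dg (t + L)) h; rewrite mulr1.
  have -> : g \o (fun u : R => u + L) = g by apply/funext.
  by move=> h'; exact: (isd_unique h' (dg t)).
have dx (t : R) : is_derive t 1 x (L * a t).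
  by apply: (isd_eq (is_derive1_comp (dg1 (ti t)) (dti t))); rewrite mulrC.
have dy (t : R) : is_derive t 1 y (L * b t).
  by apply: (isd_eq (is_derive1_comp (dg2 (ti t)) (dti t))); rewrite mulrC.
have ca : continuous a by move=> t; apply: continuous_comp; [exact: cti|exact: cdg1].
have cb : continuous b by move=> t; apply: continuous_comp; [exact: cti|exact: cdg2].
have ab1 t : a t ^+ 2 + b t ^+ 2 = 1 by exact: unit_speed.
have px t : x (t + 1) = x t by rewrite /x ti1 (per _).1.
have py t : y (t + 1) = y t by rewrite /y ti1 (per _).2.
have pa t : a (t + 1) = a t by rewrite /a ti1; apply: dgp => // u; case: (per u).
have pb t : b (t + 1) = b t by rewrite /b ti1; apply: dgp => // u; case: (per u).
have inj (t u : R) : 0 <= t < 1 -> 0 <= u < 1 -> x t = x u -> y t = y u -> t = u.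
  move=> /andP[t1 t2] /andP[u1 u2] ext eyt.
  (* Injectivity is given on [0, L), but the new parameter starts at [t0]. Integer shifts bring both
     parameters into [0, L); the shifts agree because [t] and [u] lie in [0, 1). *)
  have red (v : R) : exists n : int, 0 <= ti (v + n%:~R) < L.
    have [n] := frac (v + t0 / L) => /andP[n1 n2]; exists n.
    have -> : ti (v + n%:~R) = (v + t0 / L + n%:~R) * L.
      by rewrite /ti !mulrDl divfK ?gt_eqF//; ring.
    by rewrite mulr_ge0 ?(ltW L0)//= gtr_pMl.
  have [n nt] := red t; have [m mu] := red u.
  have : ti (t + n%:~R) = ti (u + m%:~R).
    apply: simple => //.
      by rewrite -[LHS]/(x _) -[RHS]/(x _) (per_int px t n) (per_int px u m).
    by rewrite -[LHS]/(y _) -[RHS]/(y _) (per_int py t n) (per_int py u m).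
  move=> /addrI /(mulfI (lt0r_neq0 L0)) E.
  have : `|(m - n)%:~R| < 1 :> R by rewrite intrB ltr_norml; apply/andP; split; lra.
  rewrite -intr_norm (_ : 1 = 1%:~R)// ltr_int => h.
  have mn : m = n by move: h; clear; lia.
  by rewrite mn in E; exact: addIr E.
have ptE t : pt x y t = (g1 (ti t), g2 (ti t)) by [].
have ti_surj t : exists u, ti u = t.
  by exists ((t - t0) / L); rewrite /ti mulrC divfK ?gt_eqF// addrC subrK.
have bdD' p : D p -> ~ interior D p -> exists t, p = pt x y t.
  by move=> Dp /(bdD p Dp)[t ->]; have [u <-] := ti_surj t; exists u.
have a00 : a 0 = 1 by rewrite /a /ti mulr0 addr0.
have b00 : b 0 = 0 by rewrite /b /ti mulr0 addr0.
have y0 : y 0 = g2 t0 by rewrite /y /ti mulr0 addr0.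
have ylow t : y 0 <= y t by rewrite y0; exact: low _ (Dg (ti t)).
have Dlow' p : interior D p -> y 0 < p.2 by rewrite y0; exact: Dlow.
have left' t : exists2 e : R, 0 < e & forall s : R, 0 < s < e -> interior D (tub x y a b t s).
  by have [e e0 eD] := left_in (ti t); exists e.
have cls := wnd_classify L0 dx dy ca cb ab1 px py pa pb inj clD bdD' a00 b00 ylow Dlow' left'.
have turnT := turn_tangent L0 dx dy ca cb ab1 px py pa pb inj clD bdD' a00 b00 ylow Dlow' left'.
have VU p : D p -> {for p, continuous (Vfield H)} by move=> /DU; exact: (Vfield_cont sH).
have reV t := boundary_normal oU sH sg1 sg2 unit_speed (fun t => DU _ (Dg t)) Hc noV cond (ti t).
have cG : continuous (pt x y) by move=> t; exact: (cpt dx dy).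
have G10 : pt x y 1 = pt x y 0 by exact: pt01.
have pT : nzpath (fun t => (a t, b t)).
  split=> [t|t _]; first by apply: cont_pair; [exact: ca|exact: cb].
  by rewrite -dot_gt0 /dot /= -!expr2 ab1 ltr01.
have turnV : turn (Vfield H \o pt x y) = 4 * pi.
  (* The quotient of [V] by the square of the unit tangent; [boundary_normal] says that its real
     part never vanishes, so it does not turn. *)
  pose z t := cmul (Vfield H (pt x y t)) (conjp (cmul (a t, b t) (a t, b t))).
  have cV : continuous (Vfield H \o pt x y).
    by move=> t; apply: continuous_comp; [exact: cG|apply: VU; exact: Dg].
  have cz : continuous z.
    have [cTT _] := nzpath_conj (nzpath_mul pT pT).
    by move=> t; exact: (cont_cmul (cV t) (cTT t)).
  have z0 t : (z t).1 != 0.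
    have := reV t; rewrite /z -/(a t) -/(b t) -ptE /cmul /conjp /=.
    by apply: contraNN => /eqP h; apply/eqP; rewrite -[RHS]h; ring.
  have z10 : z 1 = z 0.
    have a1 : a 1 = a 0 by have := pa 0; rewrite add0r.
    have b1 : b 1 = b 0 by have := pb 0; rewrite add0r.
    by rewrite /z G10 a1 b1.
  have pz : nzpath z by split=> // t _; rewrite pair_eq0 negb_and z0.
  have -> : Vfield H \o pt x y = (fun t => cmul (z t) (cmul (a t, b t) (a t, b t))).
    by apply/funext => t; rewrite /z cmul_unitK//; exact: ab1.
  by rewrite (turn_mul pz (nzpath_mul pT pT)) (turn_mul pT pT) turnT (turn_re_neq0 cz z10 z0); ring.
have confD p : D p -> conformal_pt H p -> interior D p.
  by move=> Dp cp; apply: contrapT => /(bdD p Dp)[t pE]; apply: (noV t); rewrite -pE.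
have [s us sP] : exists2 s : seq (R * R), uniq s & forall p, (interior D p /\ conformal_pt H p) <-> p \in s.
  apply: (@finite_isolated _ D) => // [p [/interior_subset//]|p Dp].
  have [cp|ncp] := pselect (conformal_pt H p).
    have [r r0 rP] := isol p Dp cp.
    exists [set q | cmod (q - p) < r]; split=> [||q /= qr [iq cq]].
    - have -> : [set q | cmod (q - p) < r] = (fun q => cmod (q - p)) @^-1` [set w | w < r] by [].
      by apply: open_comp => [w _|]; [exact: cont_cmod|exact: open_lt].
    - by rewrite /= subrr cmod0.
    - apply: rP => //; first exact: interior_subset.
      have := cmod_sqr (q - p) => /= <-.
      by rewrite ltr_pXn2r// nnegrE ?cmod_ge0// ltW.
  have vp : 0 < dot (Vfield H p) (Vfield H p) by rewrite dot_gt0; apply/eqP => /Vfield_eq0.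
  have near_ : \forall q \near p, 0 < dot (Vfield H q) (Vfield H q).
    exact: (cvgr_gt _ (cont_dot (VU p Dp) (VU p Dp)) _ vp).
  exists (interior [set q | 0 < dot (Vfield H q) (Vfield H q)]).
  split; [exact: open_interior|exact: near_|].
  move=> q /interior_subset /= + [_ /Vfield_eq0 V0]; by rewrite dot_gt0 V0 eqxx.
have discP p : p \in s -> exists2 r : R, 0 < r & (forall q, cmod (q - p) < r -> interior D q) /\
    (forall q, cmod (q - p) < r -> Vfield H q = 0 -> q = p).
  move=> /sP[ip cp]; have [r1 r10 r1D] := cmod_ball (open_interior D) ip.
  have [r2 r20 r2P] := isol p (interior_subset ip) cp.
  exists (Num.min r1 r2); first by rewrite lt_min r10.
  split=> q; rewrite lt_min => /andP[q1 q2]; first exact: r1D.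
  move=> /Vfield_eq0 cq; apply: r2P => //; first by apply: interior_subset; exact: r1D.
  have := cmod_sqr (q - p) => /= <-.
  by rewrite ltr_pXn2r// nnegrE ?cmod_ge0// ltW.
have /choice [ri riP] : forall p, exists ri : R * int, p \in s ->
   [/\ 0 < ri.1, (forall q, cmod (q - p) < ri.1 -> interior D q),
     (forall q, cmod (q - p) < ri.1 -> Vfield H q = 0 -> q = p),
     has_index (Vfield H) p ri.2 &
     forall rho, 0 < rho < ri.1 -> turn (Vfield H \o circ p rho) = 2 * pi * ri.2%:~R].
  move=> p; have [ps|nps] := boolP (p \in s); last by exists (0, 0).
  have [r r0 [rD rV]] := discP p ps.
  have [n np nt] := @has_index_circ _ (Vfield H) p r r0
    (fun q qr => VU q (interior_subset (rD q qr))) rV.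
  by exists (r, n).
exists s; split=> //; exists (fun p => (ri p).2); split=> [p /riP[]//|].
have pi0 := pi_gt0 R.
have sumE := @turn_index_sum _ D (Vfield H) (pt x y) s (fun p => (ri p).2) (fun p => (ri p).1) cD cG G10
  (fun t => Dg (ti t)) (fun t => nDg (ti t)) cls bdD' VU us.
have : 4 * pi = 2 * pi * (\sum_(p <- s) (ri p).2)%:~R :> R.
  rewrite -turnV; apply: sumE => [p Dp /Vfield_eq0 cp|p ps|p ps].
  - by apply/sP; split=> //; exact: confD.
  - by have [? ? ? _ _] := riP p ps; split=> //; apply/Vfield_eq0; have [] := (sP p).2 ps.
  - by have [_ _ _ _] := riP p ps.
move=> E; have : (2 : int)%:~R = (\sum_(p <- s) (ri p).2)%:~R :> R.
  apply: (mulfI (x := 2 * pi)); first by rewrite gt_eqF ?mulr_gt0.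
  by rewrite -E; ring.
by move/intr_inj.
Qed.
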